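(* Let $X$ and $Y$ be one-sided shift spaces. If $\Phi\colon\mathcal O_X\to\mathcal O_Y$ is a $^*$-isomorphism satisfying $\Phi(C(X))=C(Y)$, then $\Phi(\mathcal D_X)=\mathcal D_Y$.
   Context: **Shift spaces.** $\mathbb N=\{0,1,2,\dots\}$. A one-sided shift space is a closed subset $X\subseteq\mathfrak A^{\mathbb N}$ ($\mathfrak A$ a finite discrete alphabet, product topology) with $\sigma(X)\subseteq X$ (equality not assumed), where $\sigma(x)_n=x_{n+1}$; put $\sigma_X=\sigma|_X$. Write $x_{[i,j)}=x_i\cdots x_{j-1}$, and let $P_l(x)$ be the set of words $\mu$ of length $l$ over $\mathfrak A$ with $\mu x\in X$. **Cover.** Let $\mathcal I=\{(k,l)\in\mathbb N\times\mathbb N: k\le l\}$ with $(k_1,l_1)\preceq(k_2,l_2)$ iff $k_1\le k_2$ and $l_1-k_1\le l_2-k_2$. For $(k,l)\in\mathcal I$ let $x\overset{k,l}{\sim}x'$ iff $x_{[0,k)}=x'_{[0,k)}$ and $\bigcup_{l'\le l}P_{l'}(\sigma_X^k(x))=\bigcup_{l'\le l}P_{l'}(\sigma_X^k(x'))$; let ${}_k[x]_l$ be the class of $x$ and ${}_kX_l$ the (finite, discrete) set of classes. If $(k_1,l_1)\preceq(k_2,l_2)$ then ${}_{k_2}[x]_{l_2}\mapsto{}_{k_1}[x]_{l_1}$ is well defined, and the cover $\widetilde X$ is the projective limit of the ${}_kX_l$ along these maps, a compact Hausdorff space. The map $\sigma_{\widetilde X}\colon\widetilde X\to\widetilde X$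 is defined by: the $(k,l)$-coordinate of $\sigma_{\widetilde X}(\tilde x)$ is ${}_k[\sigma_X(y)]_l$ for any representative $y$ of the $(k+1,l+1)$-coordinate of $\tilde x$ (for $k<l$ one may use the $(k+1,l)$-coordinate); it is a local homeomorphism. The factor map $\pi_X\colon\widetilde X\to X$ sends $\tilde x$ to the unique $x\in X$ such that $x_{[0,k)}=y_{[0,k)}$ for every $(k,l)\in\mathcal I$ and every representative $y$ of the $(k,l)$-coordinate of $\tilde x$; it is a continuous surjection and $\sigma_X\circ\pi_X=\pi_X\circ\sigma_{\widetilde X}$. **Groupoid.** $\mathcal G_X=\{(\tilde x,p,\tilde y)\in\widetilde X\times\mathbb Z\times\widetilde X:\exists i,j\in\mathbb N,\ p=i-j,\ \sigma_{\widetilde X}^i(\tilde x)=\sigma_{\widetilde X}^j(\tilde y)\}$ with product $(\tilde x,p,\tilde y)(\tilde y,q,\tilde z)=(\tilde x,p+q,\tilde z)$ and inverse $(\tilde y,-p,\tilde x)$, and topology generated by the sets $\{(\tilde x,i-j,\tilde y):\tilde x\in U,\tilde y\in V,\sigma_{\widetilde X}^i(\tilde x)=\sigma_{\widetilde X}^j(\tilde y)\}$ with $U,V\subseteq\widetilde X$ open, $\sigma^i_{\widetilde X}|_U$, $\sigma^j_{\widetilde X}|_V$ injective and $\sigma_{\widetilde X}^i(U)=\sigma_{\widetilde X}^j(V)$. It is a second-countable locally compact Hausdorff étale amenable groupoid with unit space identified with $\widetilde X$. **$C^*$-algebras.** $\mathcal O_X=C^*(\mathcal G_X)$ (full = reduced),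 $\mathcal D_X=C(\widetilde X)\subseteq\mathcal O_X$ (functions on the unit space), and $C(X)$ is regarded as a subalgebra of $\mathcal D_X$ via $f\mapsto f\circ\pi_X$. *)

(* Defs.v *)
From HB Require Import structures.
From mathcomp Require Import all_boot all_order all_algebra.
From mathcomp Require Import all_classical all_reals all_analysis.
From mathcomp Require Import complex zify.

Set Implicit Arguments.
Unset Strict Implicit.
Unset Printing Implicit Defensive.

Import Order.TTheory GRing.Theory Num.Theory numFieldNormedType.Exports.

Local Open Scope classical_set_scope.
Local Open Scope ring_scope.

Definition full_shift (A : finType) :=
  prod_topology (fun _ : nat => discrete_topology A).

Section Words.
Variable A : finType.
Implicit Types (x : full_shift A) (w : seq A).

Definition shift x : full_shift A := fun n => x n.+1.

Definition prepend w x : full_shift A :=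
  foldr (fun a y n => if n is m.+1 then y m else a) x w.

Lemma iter_shiftE k x n : iter k shift x n = x (n + k)%N.
Proof. by elim: k n => [|k IH] n /=; rewrite ?addn0// /shift IH addSnnS. Qed.

Lemma prepend_cat w w' x : prepend (w ++ w') x = prepend w (prepend w' x).
Proof. by rewrite /prepend foldr_cat. Qed.

Lemma prepend_mkseq k x : prepend (mkseq x k) (iter k shift x) = x.
Proof.
elim: k x => [//|k IH] x; apply: funext => -[//|n].
rewrite iterSr -[RHS]/(shift x n) -[in RHS](IH (shift x)).
by rewrite /mkseq /= (iotaDl 1 0) -map_comp.
Qed.

End Words.

Arguments shift {A} x _.
Arguments prepend {A} w x _.

Record shift_space (A : finType) := ShiftSpace {
  shift_set :> set (full_shift A);
  shift_set_closed : closed shift_set;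
  shift_set_shift : shift @` shift_set `<=` shift_set }.

Definition cover_index := {kl : nat * nat | (kl.1 <= kl.2)%N}.

Definition mkindex k l (kl : (k <= l)%N) : cover_index :=
  exist (fun kl : nat * nat => (kl.1 <= kl.2)%N) (k, l) kl.

(* The truncated subtraction is exact, since k <= l for every index (k, l). *)
Definition index_le (i j : cover_index) : bool :=
  ((val i).1 <= (val j).1)%N &&
  ((val i).2 - (val i).1 <= (val j).2 - (val j).1)%N.

Definition index_succ (i : cover_index) : cover_index := @mkindex (val i).1.+1 (val i).2.+1 (valP i).

Section Cover.
Variables (A : finType) (X : shift_space A).
Implicit Types (x y : full_shift A) (i j : cover_index).

Definition pasts l x : set (seq A) :=
  [set w | size w = l /\ shift_set X (prepend w x)].

Definition past_sim i x x' : Prop :=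
  (forall n, (n < (val i).1)%N -> x n = x' n) /\
  \bigcup_(l in [set l | (l <= (val i).2)%N]) pasts l (iter (val i).1 shift x) =
  \bigcup_(l in [set l | (l <= (val i).2)%N]) pasts l (iter (val i).1 shift x').

Definition past_class i x : set (full_shift A) :=
  [set x' | shift_set X x' /\ past_sim i x x'].

Definition past_quotient i := set_type [set past_class i x | x in X].

Definition cover_set :
    set (prod_topology (fun i => discrete_topology (past_quotient i))) :=
  [set t | forall i j, index_le i j ->
     forall y, set_val (t j) y -> set_val (t i) = past_class i y].

(* Carries the subspace topology of the product of the discrete quotients. *)
Definition shift_cover := set_type cover_set.

Definition cover_coord (t : shift_cover) i : set (full_shift A) := set_val (set_val t i).

Lemma past_sim_refl i x : past_sim i x x. Proof. by split. Qed.

Lemma past_sim_sym i x y : past_sim i x y -> past_sim i y x.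
Proof. by case=> h1 h2; split=> // n nk; rewrite h1. Qed.

Lemma past_sim_trans i x y z :
  past_sim i x y -> past_sim i y z -> past_sim i x z.
Proof.
move=> [h1 h2] [h3 h4]; split; last by rewrite h2.
by move=> n nk; rewrite h1// h3.
Qed.

Lemma past_class_eq i x y : past_sim i x y -> past_class i x = past_class i y.
Proof.
move=> xy; apply/seteqP; split=> z [Xz h]; split=> //.
  exact: past_sim_trans (past_sim_sym xy) h.
exact: past_sim_trans xy h.
Qed.

Lemma past_classP i x y : past_class i x y -> past_class i x = past_class i y.
Proof. by case=> _; exact: past_class_eq. Qed.

Lemma shift_iterDE m k x : (m <= k)%N ->
  prepend (mkseq (iter m shift x) (k - m)) (iter k shift x) =
  iter m shift x.
Proof.
move=> mk; rewrite -{2}(subnK mk) iterD; exact: prepend_mkseq.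
Qed.

(* Monotonicity of the relations, which makes the bonding maps well defined. *)
Lemma past_sim_le i j x y : index_le i j -> past_sim j x y -> past_sim i x y.
Proof.
suff H x' y' : index_le i j -> past_sim j x' y' ->
    \bigcup_(l in [set l | (l <= (val i).2)%N])
      pasts l (iter (val i).1 shift x') `<=`
    \bigcup_(l in [set l | (l <= (val i).2)%N])
      pasts l (iter (val i).1 shift y').
  move=> ij xy; split; last by apply/seteqP; split; apply: H => //; exact: past_sim_sym.
  by move=> n ni; apply: xy.1; case/andP: ij => + _; exact: leq_trans.
case: i j => [[k1 l1] /= kl1] [[k2 l2] /= kl2]; rewrite /index_le /past_sim /=.
move=> /andP[k12 l12] [xy1 xy2] w [l' /= l'l1 [sw Xw]].
exists l' => //; split=> //.
have eqm : mkseq (iter k1 shift x') (k2 - k1) =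
           mkseq (iter k1 shift y') (k2 - k1).
  apply/eq_in_map => n; rewrite mem_iota add0n /= => nk.
  by rewrite !iter_shiftE; apply: xy1; rewrite addnC -ltn_subRL.
have : (\bigcup_(l in [set l | (l <= l2)%N]) pasts l (iter k2 shift x'))
   (w ++ mkseq (iter k1 shift x') (k2 - k1)).
  exists (l' + (k2 - k1))%N; first by rewrite /=; lia.
  split; first by rewrite size_cat size_mkseq sw.
  by rewrite prepend_cat shift_iterDE.
rewrite xy2 => -[l'' _ [_]]; by rewrite eqm prepend_cat shift_iterDE.
Qed.

Lemma past_sim_shift i x y :
  past_sim (index_succ i) x y -> past_sim i (shift x) (shift y).
Proof.
case: i => -[k l] kl /= [h1 h2]; split => [n nk|/=]; first exact: h1.
have E z : \bigcup_(l0 in [set l0 | (l0 <= l)%N])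
      pasts l0 (iter k shift (shift z)) =
    (\bigcup_(l0 in [set l0 | (l0 <= l.+1)%N])
      pasts l0 (iter k.+1 shift z)) `&` [set w | (size w <= l)%N].
  rewrite -iterSr; apply/seteqP; split => w /=.
    move=> [l0 /= l0l [sw Xw]]; split; last by rewrite sw.
    by exists l0 => //=; exact: leqW.
  by move=> [[l0 /= l0l [sw Xw]] sl]; exists (size w).
by rewrite !E; congr (_ `&` _); exact: h2.
Qed.

Lemma quotient_rep i (c : past_quotient i) :
  {x | shift_set X x & set_val c = past_class i x}.
Proof. by case: (cid2 (set_valP c)) => x Xx e; exists x. Qed.

Lemma shift_closedP x : shift_set X x -> shift_set X (shift x).
Proof. by move=> Xx; apply: (@shift_set_shift _ X); exists x. Qed.

Lemma coord_le (t : shift_cover) i j y : index_le i j -> cover_coord t j y ->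
  cover_coord t i = past_class i y.
Proof.
have tP : cover_set (set_val t) by exact: set_valP.
move=> ij cy; exact (tP i j ij y cy).
Qed.

Definition cover_rep (t : shift_cover) i : full_shift A := s2val (quotient_rep (set_val t i)).

Lemma rep_in (t : shift_cover) i : shift_set X (cover_rep t i).
Proof. exact: s2valP (quotient_rep (set_val t i)). Qed.

Lemma coord_repE (t : shift_cover) i : cover_coord t i = past_class i (cover_rep t i).
Proof. exact: s2valP' (quotient_rep (set_val t i)). Qed.

Lemma coord_rep (t : shift_cover) i : cover_coord t i (cover_rep t i).
Proof. by rewrite coord_repE; split; [exact: rep_in|exact: past_sim_refl]. Qed.

Definition cover_shift_coord (t : shift_cover) i : past_quotient i :=
  SigSub (mem_set (imageP (past_class i) (shift_closedP (rep_in t (index_succ i))))).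

Lemma cover_shift_coordE (t : shift_cover) i y : cover_coord t (index_succ i) y ->
  set_val (cover_shift_coord t i) = past_class i (shift y).
Proof.
rewrite coord_repE => /= -[_ ty]; apply: past_class_eq.
exact: past_sim_shift.
Qed.

Lemma cover_shift_subproof (t : shift_cover) : cover_set (cover_shift_coord t).
Proof.
move=> i j ij y /= [Xy rty].
have ij1 : index_le (index_succ i) (index_succ j) by [].
rewrite (cover_shift_coordE (y := cover_rep t (index_succ j))); last first.
  by rewrite (coord_le ij1 (coord_rep _ _)); split; [exact: rep_in|exact: past_sim_refl].
exact: past_class_eq (past_sim_le ij rty).
Qed.

Definition cover_shift (t : shift_cover) : shift_cover :=
  SigSub (mem_set (@cover_shift_subproof t)).

Lemma cover_shiftE (t : shift_cover) i y : cover_coord t (index_succ i) y ->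
  cover_coord (cover_shift t) i = past_class i (shift y).
Proof. exact: cover_shift_coordE. Qed.

Definition diag_index n : cover_index := mkindex (leqnn n).

Definition cover_factor (t : shift_cover) : full_shift A :=
  fun n => cover_rep t (diag_index n.+1) n.

Lemma cover_factor_coord (t : shift_cover) i y : cover_coord t i y ->
  forall n, (n < (val i).1)%N -> cover_factor t n = y n.
Proof.
move=> ty n ni.
have ni' : index_le (diag_index n.+1) i.
  by case: i {ty} ni => -[k l] /= kl nk; rewrite /index_le /= nk subnn.
have Xy : shift_set X y by move: ty; rewrite coord_repE => -[].
have : cover_coord t (diag_index n.+1) y.
  by rewrite (coord_le ni' ty); split=> //; exact: past_sim_refl.
by rewrite coord_repE => -[_ [+ _]]; apply => /=.
Qed.

Lemma cover_factor_in (t : shift_cover) : shift_set X (cover_factor t).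
Proof.
pose u k : full_shift A := cover_rep t (diag_index k).
apply: (@closed_cvg _ _ \oo _ u (shift_set X)).
- exact: shift_set_closed.
- by apply: nearW => k; exact: rep_in.
apply/cvg_sup => n U [V] [[W oW <-] Wn WU].
exists n.+1 => // k /= nk; apply: WU => /=.
by rewrite /u -(cover_factor_coord (coord_rep t (diag_index k)) (n := n)).
Qed.

(* With cover_factor_coord, this characterises cover_factor. *)
Lemma cover_factor_unique (t : shift_cover) x :
  (forall i y, cover_coord t i y -> forall n, (n < (val i).1)%N -> x n = y n) ->
  x = cover_factor t.
Proof.
by move=> h; apply: funext => n; exact: (h _ _ (coord_rep t (diag_index n.+1))).
Qed.

End Cover.

Arguments cover_shift {A X} t.
Arguments cover_factor {A X} t _.

Record groupoid (A : finType) (X : shift_space A) := Groupoid {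
  range_of : shift_cover X;
  degree : int;
  source_of : shift_cover X;
  groupoidP : exists i j : nat, degree = i%:Z - j%:Z /\
    iter i cover_shift range_of = iter j cover_shift source_of }.

HB.instance Definition _ A X := gen_eqMixin (@groupoid A X).
HB.instance Definition _ A X := gen_choiceMixin (@groupoid A X).

Section Groupoid.
Variables (A : finType) (X : shift_space A).
Local Notation G := (groupoid X).

Lemma groupoid_inv_subproof (g : G) : exists i j : nat,
  - degree g = i%:Z - j%:Z /\
  iter i cover_shift (source_of g) = iter j cover_shift (range_of g).
Proof.
case: (groupoidP g) => i [j [dg e]]; exists j, i.
by rewrite dg opprB e.
Qed.

Definition groupoid_inv (g : G) : G := Groupoid (groupoid_inv_subproof g).

(* (a, b) is composable and a b = c. *)
Definition is_product (a b c : G) : Prop :=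
  [/\ source_of a = range_of b, range_of c = range_of a,
      source_of c = source_of b & degree c = degree a + degree b].

Definition is_unit (g : G) : Prop := range_of g = source_of g /\ degree g = 0.

(* Indexed by ((U, V), (i, j)). *)
Definition bisection (b : (set (shift_cover X) * set (shift_cover X)) * (nat * nat)) : set G :=
  [set g | [/\ b.1.1 (range_of g), b.1.2 (source_of g),
     degree g = b.2.1%:Z - b.2.2%:Z &
     iter b.2.1 cover_shift (range_of g) =
     iter b.2.2 cover_shift (source_of g)]].

Definition bisection_index :
    set ((set (shift_cover X) * set (shift_cover X)) * (nat * nat)) :=
  [set b | [/\ open b.1.1, open b.1.2,
     set_inj b.1.1 (iter b.2.1 cover_shift),
     set_inj b.1.2 (iter b.2.2 cover_shift) &
     iter b.2.1 cover_shift @` b.1.1 =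
     iter b.2.2 cover_shift @` b.1.2]].

End Groupoid.

HB.instance Definition _ (A : finType) (X : shift_space A) :=
  @isSubBaseTopological.Build (groupoid X) _
    (@bisection_index A X) (@bisection A X).

HB.mixin Record CompleteNormedModule_isCStarAlgebra (R : realType) V
    of CompleteNormedModule R[i] V := {
  cmul : V -> V -> V;
  cstar : V -> V;
  cmulA : associative cmul;
  cmulDl : left_distributive cmul +%R;
  cmulDr : right_distributive cmul +%R;
  cmulZl : forall (c : R[i]) (a b : V), cmul (c *: a) b = c *: cmul a b;
  cmulZr : forall (c : R[i]) (a b : V), cmul a (c *: b) = c *: cmul a b;
  cstarD : forall a b : V, cstar (a + b) = cstar a + cstar b;
  cstarZ : forall (c : R[i]) (a : V), cstar (c *: a) = conjc c *: cstar a;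
  cstarK : involutive cstar;
  cstarM : forall a b : V, cstar (cmul a b) = cmul (cstar b) (cstar a);
  cnormM : forall a b : V, `|cmul a b| <= `|a| * `|b|;
  cnorm_cstar : forall a : V, `|cmul (cstar a) a| = `|a| ^+ 2
}.

#[short(type="cstarAlgType")]
HB.structure Definition CStarAlgebra (R : realType) :=
  {V of CompleteNormedModule R[i] V & CompleteNormedModule_isCStarAlgebra R V}.

Definition star_isomorphism (R : realType) (U V : cstarAlgType R)
    (Phi : {linear U -> V}) : Prop :=
  [/\ bijective Phi,
      forall a b, Phi (cmul a b) = cmul (Phi a) (Phi b) &
      forall a, Phi (cstar a) = cstar (Phi a)].

Section ReducedAlgebra.
Variables (R : realType) (A : finType) (X : shift_space A).
Local Notation G := (groupoid X).
Implicit Types (f : G -> R[i]^o) (x : shift_cover X).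

Definition Cc : set (G -> R[i]^o) :=
  [set f | continuous f /\ compact (closure [set g | f g != 0])].

(* Finitely supported sums only (\sum_(_ \in _) is 0 otherwise). When f is in
   Cc this is no restriction, whatever k is: the fibres of range_of are discrete
   and closed, so f is nonzero at finitely many points of each of them. *)
Definition convolution f (k : G -> R[i]^o) : G -> R[i]^o :=
  fun g => \sum_(ab \in [set ab : G * G | is_product ab.1 ab.2 g]) f ab.1 * k ab.2.

Definition involution f : G -> R[i]^o := fun g => conjc (f (groupoid_inv g)).

(* The norm of l^2(G_x), where G_x is the set of arrows with source x. *)
Definition l2norm x (xi : G -> R[i]^o) : \bar R :=
  ((\esum_(g in [set g | source_of g = x]) (ComplexField.Normc.normc (xi g) ^+ 2)%:E) `^ 2^-1)%E.

(* The operator norm of the left regular representation of f on l^2(G_x),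
   which acts as convolution by f. *)
Definition regular_rep_norm x f : \bar R :=
  ereal_sup [set l2norm x (convolution f xi) | xi in [set xi | (l2norm x xi <= 1)%E]].

(* The element 0 makes the supremum over an empty unit space equal to 0. *)
Definition reduced_norm f : \bar R :=
  ereal_sup (0%E |` [set regular_rep_norm x f | x in setT]).

End ReducedAlgebra.

(* A model of the completion of Cc in the reduced norm; such a model is
   unique up to a *-isomorphism that commutes with the embeddings of Cc. *)
Record shift_algebra (R : realType) (A : finType) (X : shift_space A) := ShiftAlgebra {
  shift_algebra_sort :> cstarAlgType R;
  embed : (groupoid X -> R[i]^o) -> shift_algebra_sort;
  embedD : forall f k, Cc f -> Cc k -> embed (f + k) = embed f + embed k;
  embedZ : forall (c : R[i]) f, Cc f -> embed (c *: f) = c *: embed f;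
  embedM : forall f k, Cc f -> Cc k -> embed (convolution f k) = cmul (embed f) (embed k);
  embed_star : forall f, Cc f -> embed (involution f) = cstar (embed f);
  embed_norm : forall f, Cc f -> (complex.Re `|embed f|)%:E = reduced_norm f;
  embed_dense : closure (embed @` @Cc R A X) = setT }.

Section Subalgebras.
Variables (R : realType) (A : finType) (X : shift_space A) (O : shift_algebra R X).

Definition extend_units (h : shift_cover X -> R[i]^o) : groupoid X -> R[i]^o :=
  fun g => if `[< is_unit g >] then h (range_of g) else 0.

(* The image of C(shift_cover X), as functions on the unit space. *)
Definition diagonal_subalgebra : set O :=
  [set embed O (extend_units h) | h in [set h | continuous h]].

(* The image of C(X); {within X, continuous f} only depends on f on X, and
   cover_factor takes its values in X. *)
Definition shift_subalgebra : set O :=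
  [set embed O (extend_units (f \o cover_factor)) |
    f in [set f : full_shift A -> R[i]^o | {within X, continuous f}]].

End Subalgebras.

Arguments diagonal_subalgebra {R A X} O _.
Arguments shift_subalgebra {R A X} O _.

(* Main.v *)
From HB Require Import structures.
From mathcomp Require Import all_boot all_order all_algebra.
From mathcomp Require Import all_classical all_reals all_analysis.
From mathcomp Require Import finmap complex zify ring lra.
Require Import Defs.

Set Implicit Arguments.
Unset Strict Implicit.
Unset Printing Implicit Defensive.

Import Order.TTheory GRing.Theory Num.Theory numFieldNormedType.Exports.

Local Open Scope classical_set_scope.
Local Open Scope ring_scope.

(** The diagonal D_X can be recovered from the algebra O_X and its subalgebra
    C(X), through the relative commutant N_X of C(X) in O_X. The isomorphism
    carries N_X onto N_Y, and D_X is contained in N_X.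

    Elements of O_X are determined by their coefficients, which are continuous
    functions on the groupoid ([coef_inj]), and D_X consists of the elements
    whose coefficients vanish off the units ([units_in_diagonal]). The
    coefficients of an element of N_X live on arrows whose two ends lie over the
    same point of X. Such an arrow of degree 0 is a unit. If an arrow of degree
    i - j <> 0 has a neighbourhood of such arrows, then the points x of X below
    it satisfy sigma^i x = sigma^j x, and there is only one such x nearby;
    as X is dense in the cover, the two ends of the arrow are isolated, hence
    equal ([open_fiber_isotropy]). So N_X is like the algebra of continuous
    functions on a space obtained from the cover by blowing up certain isolated
    points to circles.

    Circles are connected, so all idempotents of N_X belong to D_X
    ([commutant_idempotent]). To see this without computing the spectrum of N_X,
    let p be an idempotent over one of these isolated points. The gauge action
    of the circle moves p continuously among idempotents that commute with p,
    and commuting idempotents at distance less than 1 are equal. Hence p is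
    invariant under the gauge action near 1, and its coefficients of nonzero
    degree vanish ([isotropic_idempotent]).

    Now let b be the image in N_Y of an element of D_X. By the above, its
    coefficients off the units have to be examined only over isolated points y
    of the cover of Y. The indicator e of y is an idempotent of N_Y, so its
    preimage in N_X is an idempotent of D_X. This preimage is supported on a
    single point, because cutting it with a clopen set gives an idempotent that
    is mapped to a multiple of e ([Psi_isolated_indicator]). Therefore e b is a
    multiple of e, and b has no coefficients off the units over y
    ([Phi_diagonal]). The inverse isomorphism gives the other inclusion. *)

(** * The topology of the cover *)

(** The indices (N, 2N) form a cofinal chain, so that a single number measures
    how precisely a point of the cover is known; each shift costs one level. *)
Definition level (N : nat) : cover_index := mkindex (leq_addr N N).

Lemma level_le N M : (N <= M)%N -> index_le (level N) (level M).
Proof. by rewrite /index_le /= !addKn => ->. Qed.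

Lemma index_le_level i N : ((val i).2 <= N)%N -> index_le i (level N).
Proof. by case: i => -[k l] /= kl lN; rewrite /index_le /= addKn; lia. Qed.

Section CoverTopology.
Variables (A : finType) (X : shift_space A).
Implicit Types (x y : full_shift A) (t s : shift_cover X) (i j : cover_index).

Lemma coord_class t i y : cover_coord t i y -> cover_coord t i = past_class X i y.
Proof. by rewrite coord_repE => /past_classP. Qed.

Lemma coord_in t i y : cover_coord t i y -> shift_set X y.
Proof. by rewrite coord_repE => -[]. Qed.

Lemma class_refl i y : shift_set X y -> past_class X i y y.
Proof. by move=> Xy; split=> //; exact: past_sim_refl. Qed.

Lemma coord_down t i j y : index_le i j ->
  cover_coord t j y -> cover_coord t i y.
Proof.
by move=> ij ty; rewrite (coord_le ij ty); apply: class_refl; exact: coord_in ty.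
Qed.

Lemma coord_eq_down t s i j : index_le i j ->
  cover_coord t j = cover_coord s j -> cover_coord t i = cover_coord s i.
Proof.
move=> ij e; have ty := coord_rep t j.
have sy : cover_coord s j (cover_rep t j) by rewrite -e.
by rewrite (coord_le ij ty) (coord_le ij sy).
Qed.

Lemma coord_sim t i y y' : cover_coord t i y -> cover_coord t i y' ->
  past_sim X i y y'.
Proof. by move=> /coord_class -> []. Qed.

Lemma cover_ext t s :
  (forall N, cover_coord t (level N) = cover_coord s (level N)) -> t = s.
Proof.
move=> h; apply: val_inj; apply: functional_extensionality_dep => i.
apply: val_inj; have := @coord_eq_down t s i _ (index_le_level (leqnn _)) (h _).
by [].
Qed.

Lemma cover_shift_level t N y : cover_coord t (level N.+1) y ->
  cover_coord (cover_shift t) (level N) = past_class X (level N) (shift y).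
Proof.
move=> ty; apply: cover_shiftE; apply: coord_down ty.
by rewrite /index_le /=; lia.
Qed.

(** A word placed before x is part of a past of the k-th shift of x, which is
    longer by k letters: hence the size condition. *)
Lemma past_sim_prepend i x x' w : past_sim X i x x' ->
  (size w + (val i).1 <= (val i).2)%N ->
  shift_set X (prepend w x) -> shift_set X (prepend w x').
Proof.
case: i => -[k l] /= kl [h1 h2] /= sw Xw.
have e : mkseq x k = mkseq x' k.
  by apply/eq_in_map => n; rewrite mem_iota => /h1.
have : (\bigcup_(l' in [set l' | (l' <= l)%N]) pasts X l' (iter k shift x))
    (w ++ mkseq x k).
  exists (size (w ++ mkseq x k)); first by rewrite /= size_cat size_mkseq.
  by split=> //; rewrite prepend_cat prepend_mkseq.
by rewrite h2 e => -[l' _ [_]]; rewrite prepend_cat prepend_mkseq.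
Qed.

(** The past sets of y after k + 1 letters are those of its shift after k
    letters, so the class of the shift only misses the first letter of y. *)
Lemma past_sim_unshift N y y' : past_sim X (level N.+1) (shift y) (shift y') ->
  y 0%N = y' 0%N -> past_sim X (level N) y y'.
Proof.
move=> [h1 h2] e0.
have kl : (N.+2 <= N.+1 + N.+1)%N by lia.
have le : index_le (level N) (mkindex kl) by rewrite /index_le /=; lia.
apply: past_sim_le le _; split=> /=.
  by move=> [//|n] nk; exact: (h1 n).
by move: h2; rewrite /= -!iterSr.
Qed.

Lemma cover_factor0 t N y : cover_coord t (level N.+1) y ->
  cover_factor t 0%N = y 0%N.
Proof. by move/cover_factor_coord; exact. Qed.

Lemma cover_factor_shift t : cover_factor (cover_shift t) = shift (cover_factor t).
Proof.
apply: funext => n; have ty := coord_rep t (level n.+2).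
have sy : cover_coord (cover_shift t) (level n.+1) (shift (cover_rep t (level n.+2))).
  by rewrite (cover_shift_level ty); apply: class_refl; apply: shift_closedP; exact: rep_in.
by rewrite (cover_factor_coord sy) // /shift (cover_factor_coord ty).
Qed.

Lemma cover_factor_iter n t :
  cover_factor (iter n cover_shift t) = iter n shift (cover_factor t).
Proof. by elim: n => //= n IH; rewrite cover_factor_shift IH. Qed.

(** By [past_sim_unshift], the shift forgets nothing but the first letter. *)
Lemma cover_shift_inj t s : cover_shift t = cover_shift s ->
  cover_factor t 0%N = cover_factor s 0%N -> t = s.
Proof.
move=> e e0; apply: cover_ext => N.
have ty := coord_rep t (level N.+2); have sy := coord_rep s (level N.+2).
move: e0; rewrite (cover_factor0 ty) (cover_factor0 sy) => e0.
have le : index_le (level N) (level N.+2) by apply: level_le; lia.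
rewrite (coord_le le ty) (coord_le le sy); apply: past_class_eq.
apply: past_sim_unshift => //.
have := cover_shift_level ty; rewrite e (cover_shift_level sy) => e'.
have : past_class X (level N.+1) (shift (cover_rep t (level N.+2)))
                    (shift (cover_rep s (level N.+2))).
  by rewrite -e'; apply: class_refl; apply: shift_closedP; exact: rep_in.
by case.
Qed.

Lemma iter_cover_shift_inj n t s : iter n cover_shift t = iter n cover_shift s ->
  (forall m, (m < n)%N -> cover_factor t m = cover_factor s m) -> t = s.
Proof.
elim: n t s => [//|n IH] t s; rewrite !iterSr => e h.
apply: cover_shift_inj; last exact: h.
by apply: IH => // m mn; rewrite !cover_factor_shift; exact: h.
Qed.

Lemma prepend_coord t N a y :
  shift_set X (prepend [:: a] y) -> cover_coord t (level N.+1) y ->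
  forall M z, cover_coord t (level M.+1) z -> shift_set X (prepend [:: a] z).
Proof.
move=> Xy ty M z tz.
have d1 m w : cover_coord t (level m.+1) w -> cover_coord t (level 1) w.
  by apply: coord_down; exact: level_le.
exact: past_sim_prepend (coord_sim (d1 _ _ ty) (d1 _ _ tz)) _ Xy.
Qed.

(** The preimage is built by prepending the letter to all representatives:
    [past_sim_prepend] keeps them in X, and [past_sim_unshift] makes their classes
    coherent. *)
Lemma cover_prepend t N a y :
  shift_set X (prepend [:: a] y) -> cover_coord t (level N.+1) y ->
  exists t', cover_shift t' = t /\
    forall M z, cover_coord t (level M.+1) z ->
      cover_coord t' (level M) (prepend [:: a] z).
Proof.
move=> Xy ty; have Xa := prepend_coord Xy ty.
pose r i := prepend [:: a] (cover_rep t (level (val i).2.+1)).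
have Xr i : shift_set X (r i) by apply: Xa; exact: coord_rep.
pose c i : past_quotient X i := SigSub (mem_set (imageP (past_class X i) (Xr i))).
have sim i M z : ((val i).2 <= M)%N -> cover_coord t (level M.+1) z ->
    past_sim X i (r i) (prepend [:: a] z).
  move=> iM tz; apply: past_sim_le (index_le_level (leqnn _)) _.
  apply: past_sim_unshift => //.
  apply: (@coord_sim t); first exact: coord_rep.
  by apply: coord_down tz; exact: level_le.
have cP : cover_set (c : prod_topology _).
  move=> i j ij z /= [Xz sz]; apply: past_class_eq.
  apply: past_sim_trans _ (past_sim_le ij sz).
  apply: sim; last exact: coord_rep.
  by case: i j ij {sz} => -[k1 l1] /= h1 [[k2 l2] /= h2]; rewrite /index_le /=; lia.
pose t' : shift_cover X := SigSub (mem_set cP).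
have t'P M z : cover_coord t (level M.+1) z ->
    cover_coord t' (level M) (prepend [:: a] z).
  move=> tz; split; first exact: Xa tz.
  have tz' := coord_rep t (level (M + M).+1).
  apply: past_sim_trans (sim (level M) _ _ (leqnn _) tz') _.
  apply: past_sim_unshift => //; apply: (@coord_sim t) => //.
  by apply: coord_down tz'; apply: level_le; lia.
exists t'; split=> //; apply: cover_ext => M.
have tz := coord_rep t (level M.+2).
rewrite (cover_shift_level (t'P _ _ tz)) (@coord_class t _ (cover_rep t (level M.+2))) //.
by apply: coord_down tz; apply: level_le; lia.
Qed.

Lemma coord_open t i : open [set s : shift_cover X | cover_coord s i = cover_coord t i].
Proof.
pose c : past_quotient X i := set_val t i.
have -> : [set s : shift_cover X | cover_coord s i = cover_coord t i] =
    (fun s : shift_cover X => set_val s i : discrete_topology (past_quotient X i))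
      @^-1` [set c].
  by apply/seteqP; split=> s /=; [move/val_inj|move/(congr1 set_val)].
apply: open_comp; last exact: discrete_open.
pose D j := discrete_topology (past_quotient X j).
pose p : prod_topology D -> D i := fun f => f i.
have cp : continuous p by exact: (@proj_continuous _ D i).
move=> s _; exact: (@continuous_comp _ _ _ set_val p s (@initial_continuous _ _ _ s) (cp _)).
Qed.

Lemma cover_cvg (F : set_system (shift_cover X)) t : Filter F ->
  (forall N, F [set s : shift_cover X | cover_coord s (level N) = cover_coord t (level N)]) ->
  F --> t.
Proof.
move=> FF h.
pose P := prod_topology (fun i => discrete_topology (past_quotient X i)).
suff H : (set_val @ F) --> (set_val t : P).
  move=> U; rewrite nbhsE => -[V [[W oW <-] Wt] VU].
  have : nbhs (set_val t : P) W by exact: open_nbhs_nbhs.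
  by move=> /H FW; exact: (filterS VU FW).
apply/cvg_sup => i U [V] [[W oW <-] Wt WU].
suff : F (set_val @^-1` U) by [].
have := h (val i).2; apply: filterS => s /= e; apply: WU => /=.
have := coord_eq_down (index_le_level (leqnn _)) e.
by rewrite /cover_coord => /val_inj e'; exact: (eq_ind_r W Wt e').
Qed.

(** Each coordinate is determined by some level, so the levels give a countable
    neighbourhood base. *)
Lemma cover_nbhsP t (U : set (shift_cover X)) : nbhs t U <->
  exists N, forall s, cover_coord s (level N) = cover_coord t (level N) -> U s.
Proof.
split; last first.
  move=> [N h]; apply: filterS h _; apply: open_nbhs_nbhs; split=> //.
  exact: coord_open.
pose F := filter_from [set: nat]
  (fun N : nat => [set s : shift_cover X | cover_coord s (level N) = cover_coord t (level N)]).
have FF : Filter F.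
  apply: filter_from_filter; first by exists 0%N.
  move=> N M _ _; exists (maxn N M) => // s /= e.
  by split=> /=; apply: coord_eq_down e; apply: level_le; rewrite ?leq_maxl ?leq_maxr.
have : F --> t by apply: cover_cvg => N; exists N.
by move=> /[apply] -[N _ h]; exists N.
Qed.

Lemma cover_shift_continuous : continuous (@cover_shift A X).
Proof.
move=> t U /cover_nbhsP[N h]; apply/cover_nbhsP; exists N.+1 => s e.
apply: h; have ty := coord_rep t (level N.+1).
by rewrite (cover_shift_level ty) -(@cover_shift_level s) // e.
Qed.

(** The inverse branch of the shift at t prepends the first letter of t, which
    is possible for every point that agrees with the shift of t at a fine level. *)
Lemma cover_shift_local t N : exists M, forall s,
  cover_coord s (level M) = cover_coord (cover_shift t) (level M) ->
  exists t', cover_shift t' = s /\ cover_coord t' (level N) = cover_coord t (level N).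
Proof.
exists N.+1 => s e; have ty := coord_rep t (level N.+2).
set y := cover_rep t (level N.+2) in ty.
have yE : prepend [:: y 0%N] (shift y) = y by apply: funext => -[].
have sy : cover_coord s (level N.+1) (shift y).
  rewrite e (cover_shift_level ty); apply: class_refl; apply: shift_closedP.
  exact: coord_in ty.
have Xy : shift_set X (prepend [:: y 0%N] (shift y)) by rewrite yE; exact: coord_in ty.
have [t' [st' t'P]] := cover_prepend Xy sy.
exists t'; split=> //; have := t'P _ _ sy; rewrite yE => /coord_class ->.
by rewrite (@coord_class t _ y) //; apply: coord_down ty; apply: level_le; lia.
Qed.

Lemma cover_shift_open (U : set (shift_cover X)) : open U -> open (cover_shift @` U).
Proof.
rewrite !openE => oU _ [t Ut <-]; apply/cover_nbhsP.
have [N hN] := (cover_nbhsP _ _).1 (oU _ Ut).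
have [M hM] := cover_shift_local t N.
by exists M => s /hM[t' [<- /hN Ut']]; exists t'.
Qed.

Lemma iter_cover_shift_continuous n : continuous (iter n (@cover_shift A X)).
Proof.
elim: n => [t|n IH t]; first exact: cvg_id.
by apply: (@continuous_comp _ _ _ (iter n cover_shift));
  [exact: IH|exact: cover_shift_continuous].
Qed.

Lemma iter_cover_shift_open n (U : set (shift_cover X)) :
  open U -> open (iter n cover_shift @` U).
Proof.
elim: n => [|n IH] oU; first by rewrite image_id.
have -> : iter n.+1 cover_shift @` U = cover_shift @` (iter n cover_shift @` U).
  by rewrite image_comp.
by apply: cover_shift_open; exact: IH.
Qed.

Lemma cylinder_open t n :
  open [set s : shift_cover X | forall m, (m < n)%N -> cover_factor s m = cover_factor t m].
Proof.
rewrite openE => s sn; apply/cover_nbhsP; exists n => s' e m mn.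
rewrite -sn //; have sy := coord_rep s (level n).
rewrite (cover_factor_coord sy) //.
by rewrite (@cover_factor_coord _ _ s' (level n) (cover_rep s (level n))) ?e.
Qed.

Lemma cover_factor_continuous : continuous (@cover_factor A X).
Proof.
move=> t.
have FF : Filter (@cover_factor A X @ nbhs t) by exact: fmap_filter.
apply/cvg_sup => n U [V] [[W oW <-] Wt WU].
suff : nbhs t (@cover_factor A X @^-1` U) by [].
have : nbhs t [set s | forall m, (m < n.+1)%N -> cover_factor s m = cover_factor t m].
  by apply: open_nbhs_nbhs; split=> //; exact: cylinder_open.
by apply: filterS => s /= e; apply: WU => /=; rewrite e.
Qed.

Lemma cover_neqP t s : t <> s -> exists N,
  cover_coord s (level N) <> cover_coord t (level N).
Proof.
move=> ts; apply: contrapT => h; apply: ts; apply: cover_ext => N.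
by apply: contrapT => e; apply: h; exists N => e'; apply: e.
Qed.

Lemma cover_set1_closed t : closed [set t].
Proof.
rewrite -[[set t]]setCK closedC openE => s /= st.
have [N hN] := cover_neqP (nesym st).
by apply/cover_nbhsP; exists N => s' e es; apply: hN; rewrite -e es.
Qed.

Lemma cover_separate t s : t <> s -> exists U V : set (shift_cover X),
  [/\ open U, open V, U t, V s & U `&` V = set0].
Proof.
move=> /cover_neqP[N hN].
exists [set r : shift_cover X | cover_coord r (level N) = cover_coord t (level N)].
exists [set r : shift_cover X | cover_coord r (level N) = cover_coord s (level N)].
split=> //; try exact: coord_open.
by apply/seteqP; split=> // r /= [-> e]; apply: hN.
Qed.

(** A class is given by a word of length k and by a set of words of length at
    most l. *)
Lemma past_quotient_finite i : finite_set [set past_class X i x | x in X].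
Proof.
case: i => -[k l] kl.
pose i : cover_index := mkindex kl.
pose words x : {set l.-bseq A} :=
  [set w : l.-bseq A | `[< shift_set X (prepend w (iter k shift x)) >]]%SET.
pose F (c : k.-tuple A * {set l.-bseq A}) : set (full_shift A) :=
  [set x | shift_set X x /\ mkseq x k = c.1 /\ words x = c.2].
apply: (@sub_finite_set _ _ (F @` setT)); last first.
  by apply: finite_image; exact: finite_finset.
move=> _ [x Xx <-]; exists (Tuple (introT eqP (size_mkseq x k)), words x) => //.
apply/seteqP; split=> y /=.
  move=> [Xy [/= e1 e2]]; split=> //; split=> /=.
    move=> n nk; have := congr1 (fun w : seq A => nth (x 0%N) w n) e1.
    by rewrite !nth_mkseq // => ->.
  have h u v : words u = words v ->
     \bigcup_(l' in [set l' | (l' <= l)%N]) pasts X l' (iter k shift u) `<=`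
     \bigcup_(l' in [set l' | (l' <= l)%N]) pasts X l' (iter k shift v).
    move=> e w [l' /= l'l [sw Xw]]; exists l' => //; split=> //.
    have sl : (size w <= l)%N by rewrite sw.
    have /setP/(_ (Bseq sl)) := e; rewrite !inE /= => /esym.
    by rewrite (asboolT Xw) => /asboolP.
  by apply/seteqP; split; apply: h.
move=> [Xy [/= h1 h2]]; split=> //; split.
  by apply/eq_in_map => n; rewrite mem_iota => /andP[_ /h1].
have h u v : \bigcup_(l' in [set l' | (l' <= l)%N]) pasts X l' (iter k shift u) =
     \bigcup_(l' in [set l' | (l' <= l)%N]) pasts X l' (iter k shift v) ->
     forall w : l.-bseq A, shift_set X (prepend w (iter k shift u)) ->
       shift_set X (prepend w (iter k shift v)).
  move=> e w Xw.
  have : (\bigcup_(l' in [set l' | (l' <= l)%N]) pasts X l' (iter k shift u)) w.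
    by exists (size w) => //=; exact: size_bseq.
  by rewrite e => -[l' _ [_]].
by apply/setP => w; rewrite !inE; apply/asboolP/asboolP; exact: h.
Qed.

(** An ultrafilter selects one of the finitely many classes at each index. Two
    selected classes are coordinates of a common point, hence coherent. *)
Lemma cover_compact : compact [set: shift_cover X].
Proof.
rewrite compact_ultra => F FU _.
have /choice[c hc] : forall i, exists C,
    F [set t : shift_cover X | cover_coord t i = C].
  move=> i.
  pose f t : discrete_topology (set (full_shift A)) := cover_coord t i.
  pose S : set (discrete_topology (set (full_shift A))) := [set past_class X i x | x in X].
  have cS : compact S by apply: finite_compact; exact: past_quotient_finite.
  have [|C [_ clC]] := cS (f @ F) _.
    suff : F (f @^-1` S) by [].
    apply: filterS (@filterT _ F _) => t _.
    by exists (cover_rep t i); [exact: rep_in|exact/esym/coord_repE].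
  exists C; have [//|nC] := in_ultra_setVsetC [set t | cover_coord t i = C] FU.
  have [//|D [nD DC]] := clC (~` [set C]) [set C] _ (discrete_set1 _).
  by case: nD.
have cR i : [set past_class X i x | x in X] (c i).
  have [t /= <-] := filter_ex (hc i).
  by exists (cover_rep t i); [exact: rep_in|exact/esym/coord_repE].
pose d i : past_quotient X i := SigSub (mem_set (cR i)).
have dP : cover_set (d : prod_topology _).
  move=> i j ij y; change (c j y -> c i = past_class X i y).
  have [t [/= <- <-]] := filter_ex (filterI (hc i) (hc j)); exact: coord_le.
exists (SigSub (mem_set dP)); split=> //=.
by apply: cover_cvg => N; exact: hc.
Qed.

End CoverTopology.

(** * The topology of the groupoid *)

Section GroupoidTopology.
Variables (A : finType) (X : shift_space A).
Local Notation G := (groupoid X).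
Implicit Types (g : G) (t s : shift_cover X).
Local Notation box := ((set (shift_cover X) * set (shift_cover X)) * (nat * nat))%type.

Lemma groupoid_eq g g' : range_of g = range_of g' -> degree g = degree g' ->
  source_of g = source_of g' -> g = g'.
Proof.
case: g g' => [r d s p] [r' d' s' p'] /= er ed es; subst r' d' s'.
by congr Groupoid; exact: Prop_irrelevance.
Qed.

Lemma arrow_witness g n : exists i j, [/\ (n <= i)%N, (n <= j)%N,
  degree g = i%:Z - j%:Z &
  iter i cover_shift (range_of g) = iter j cover_shift (source_of g)].
Proof.
have [i [j [dg e]]] := groupoidP g.
exists (n + i)%N, (n + j)%N; split; [lia|lia|lia|].
by rewrite !iterD e.
Qed.

(** On the cylinders that bound the two sides the iterated shifts are injective
    ([iter_cover_shift_inj]), and this persists for all smaller exponents. *)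
Definition thin_box g (b : box) : Prop :=
  [/\ bisection_index b, bisection b g,
   forall u, b.1.1 u -> forall m, (m < b.2.1)%N ->
     cover_factor u m = cover_factor (range_of g) m &
   forall v, b.1.2 v -> forall m, (m < b.2.2)%N ->
     cover_factor v m = cover_factor (source_of g) m].

(** As the shift is continuous and open, both sides can be cut down to the
    preimages of a common open image. *)
Lemma thin_box_exists g (U V : set (shift_cover X)) n :
  nbhs (range_of g) U -> nbhs (source_of g) V ->
  exists b : box, [/\ thin_box g b, b.1.1 `<=` U, b.1.2 `<=` V,
    (n <= b.2.1)%N & (n <= b.2.2)%N].
Proof.
rewrite !nbhsE => -[U1 [oU1 U1r] U1U] [V1 [oV1 V1s] V1V].
have [i [j [ni nj dg e]]] := arrow_witness g n.
pose U2 := U1 `&`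
  [set u | forall m, (m < i)%N -> cover_factor u m = cover_factor (range_of g) m].
pose V2 := V1 `&`
  [set u | forall m, (m < j)%N -> cover_factor u m = cover_factor (source_of g) m].
have oU2 : open U2 by apply: openI => //; exact: cylinder_open.
have oV2 : open V2 by apply: openI => //; exact: cylinder_open.
pose O := iter i cover_shift @` U2 `&` iter j cover_shift @` V2.
have oO : open O by apply: openI; exact: iter_cover_shift_open.
pose U3 := U2 `&` iter i cover_shift @^-1` O.
pose V3 := V2 `&` iter j cover_shift @^-1` O.
have oU3 : open U3.
  by apply: openI => //; apply: open_comp oO => t _; exact: iter_cover_shift_continuous.
have oV3 : open V3.
  by apply: openI => //; apply: open_comp oO => t _; exact: iter_cover_shift_continuous.
have Or : O (iter i cover_shift (range_of g)).
  by split; [exists (range_of g)|rewrite e; exists (source_of g)].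
have Os : O (iter j cover_shift (source_of g)) by rewrite -e.
exists ((U3, V3), (i, j)); split=> //=.
- split=> //=.
  + split=> //=.
    * move=> u u' /set_mem[[_ hu] _] /set_mem[[_ hu'] _] /iter_cover_shift_inj; apply.
      by move=> m mi; rewrite hu// hu'.
    * move=> u u' /set_mem[[_ hu] _] /set_mem[[_ hu'] _] /iter_cover_shift_inj; apply.
      by move=> m mi; rewrite hu// hu'.
    * apply/seteqP; split=> _ [u [U2u Ou] <-].
        have [_ [v V2v ev]] := Ou; exists v => //; split=> //=.
        by rewrite /preimage /= ev.
      have [[v V2v ev] _] := Ou; exists v => //; split=> //=.
      by rewrite /preimage /= ev.
  + by move=> u [[_ hu] _].
  + by move=> u [[_ hu] _].
- by move=> u [[/U1U]].
- by move=> u [[/V1V]].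
Qed.

(** Two points with the same leading letters and the same iterated shift are
    equal, so the equation of the larger exponents implies that of the smaller ones. *)
Lemma thin_box_sub g (b b0 : box) : bisection b0 g -> thin_box g b ->
  b.1.1 `<=` b0.1.1 -> b.1.2 `<=` b0.1.2 -> (b0.2.1 <= b.2.1)%N ->
  bisection b `<=` bisection b0.
Proof.
case: b b0 => [[U V] [i j]] [[U0 V0] [i0 j0]].
move=> [/= _ _ d0 e0] [_ [/= _ _ d _] hu hv] /= sU sV li.
move=> h [/= Uh Vh dh eh]; have jE : (j = (i - i0) + j0)%N by lia.
have iE : (i = (i - i0) + i0)%N by lia.
split=> /=; [exact: sU|exact: sV|by rewrite dh -d|].
move: eh; rewrite {1}iE jE !iterD.
move/iter_cover_shift_inj; apply => m mi.
rewrite !cover_factor_iter !iter_shiftE [LHS]hu//=; last by lia.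
rewrite [RHS]hv//=; last by lia.
by rewrite -!iter_shiftE -!cover_factor_iter e0.
Qed.

(** By [thin_box_sub] the thin boxes around an arrow are directed, so that the
    finite intersections of subbasic sets may be replaced with single boxes. *)
Lemma groupoid_nbhsP g (W : set G) : nbhs g W <->
  exists2 b, thin_box g b & bisection b `<=` W.
Proof.
split; last first.
  move=> [b [ib gb _ _] bW]; rewrite nbhsE; exists (bisection b) => //; split=> //.
  exists [set bisection b]; last by rewrite bigcup_set1.
  move=> _ ->; exists [fset b]%fset.
    by move=> c; rewrite in_fset1 => /eqP ->; exact: mem_set.
  by rewrite set_fset1 bigcap_set1.
pose F := filter_from (thin_box g) (@bisection A X).
have FF : Filter F.
  apply: filter_from_filter.
    by have [b [hb _ _ _ _]] := @thin_box_exists g setT setT 0%N filterT filterT; exists b.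
  move=> b1 b2 t1 t2; have [[w1 w1' _ _ _] g1 _ _] := t1; have [[w2 w2' _ _ _] g2 _ _] := t2.
  have [U1r V1s _ _] := g1; have [U2r V2s _ _] := g2.
  have nU : nbhs (range_of g) (b1.1.1 `&` b2.1.1).
    by apply: open_nbhs_nbhs; split=> //; exact: openI.
  have nV : nbhs (source_of g) (b1.1.2 `&` b2.1.2).
    by apply: open_nbhs_nbhs; split=> //; exact: openI.
  have [b [tb bU bV n1 n2]] := thin_box_exists (maxn b1.2.1 b2.2.1) nU nV.
  exists b => //; rewrite subsetI; split.
    apply: (thin_box_sub g1 tb); first by move=> u /bU[].
      by move=> u /bV[].
    by apply: leq_trans n1; exact: leq_maxl.
  apply: (thin_box_sub g2 tb); first by move=> u /bU[].
    by move=> u /bV[].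
  by apply: leq_trans n1; exact: leq_maxr.
rewrite nbhsE => -[_ [[B sB <-] [C BC Cg]] sUBW].
suff : F W by move=> [b tb bW]; exists b.
apply: (@filterS _ F _ C); first by move=> h Ch; apply: sUBW; exists C.
have /sB[D sD DC] := BC; rewrite -DC; apply: filter_bigI => b Db.
have /sD/set_mem[wU wV _ _ _] := Db.
have gb : bisection b g by move: Cg; rewrite -DC; apply.
have [Ur Vs _ _] := gb.
have [b' [tb' bU bV n1 _]] := thin_box_exists b.2.1
  (open_nbhs_nbhs (conj wU Ur)) (open_nbhs_nbhs (conj wV Vs)).
by exists b' => //; exact: thin_box_sub gb tb' bU bV n1.
Qed.

Lemma range_continuous : continuous (@range_of A X).
Proof.
move=> g U nU; apply/groupoid_nbhsP.
have [b [tb bU _ _ _]] := @thin_box_exists g U setT 0%N nU filterT.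
by exists b => // h [/bU].
Qed.

Lemma source_continuous : continuous (@source_of A X).
Proof.
move=> g U nU; apply/groupoid_nbhsP.
have [b [tb _ bU _ _]] := @thin_box_exists g setT U 0%N filterT nU.
by exists b => // h [_ /bU].
Qed.

Lemma degree_locally_constant g : \forall h \near g, degree h = degree g.
Proof.
apply/groupoid_nbhsP.
have [b [tb _ _ _ _]] := @thin_box_exists g setT setT 0%N filterT filterT.
exists b => // h [_ _ -> _]; by have [_ [_ _ -> _] _ _] := tb.
Qed.

Lemma unit_arrow_subproof t : exists i j : nat, (0 : int) = i%:Z - j%:Z /\
  iter i cover_shift t = iter j cover_shift t.
Proof. by exists 0%N, 0%N. Qed.

Definition unit_arrow t : G := Groupoid (unit_arrow_subproof t).

Lemma is_unitE g : is_unit g -> g = unit_arrow (range_of g).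
Proof. by move=> [rs d0]; exact: groupoid_eq. Qed.

Lemma unit_arrow_continuous : continuous unit_arrow.
Proof.
move=> t W /groupoid_nbhsP[b [[wU wV _ _ _] [/= Ut Vt d _] _ _] bW].
have : nbhs t (b.1.1 `&` b.1.2).
  by apply: open_nbhs_nbhs; split=> //; exact: openI.
apply: filterS => u [Uu Vu]; apply: bW; split=> //=.
by have -> : b.2.1 = b.2.2 by lia.
Qed.

Lemma nbhs_is_unit g : is_unit g -> nbhs g (@is_unit A X).
Proof.
move=> ug; apply/groupoid_nbhsP.
have [b [tb _ _ _ _]] := @thin_box_exists g setT setT 0%N filterT filterT.
exists b => // h [Uh Vh dh eh]; have [_ [_ _ d _] hu hv] := tb.
have [rs d0] := ug.
split; last by rewrite dh -d.
have ij : b.2.1 = b.2.2 by lia.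
move: eh; rewrite -ij => /iter_cover_shift_inj; apply => m mi.
by rewrite [LHS]hu// [RHS]hv -?ij// rs.
Qed.

Lemma nbhs_not_unit g : ~ is_unit g -> nbhs g (~` (@is_unit A X)).
Proof.
move=> ug; have [d0|d0] := eqVneq (degree g) 0.
  have /cover_separate[U [V [oU oV Ur Vs UV]]] : range_of g <> source_of g.
    by move=> rs; apply: ug.
  have : nbhs g (@range_of A X @^-1` U `&` @source_of A X @^-1` V).
    apply: filterI.
      by apply: range_continuous; exact: open_nbhs_nbhs.
    by apply: source_continuous; exact: open_nbhs_nbhs.
  apply: filterS => h [Uh Vh] [rs _].
  suff : (U `&` V) (range_of h) by rewrite UV.
  by split=> //; rewrite rs.
have := degree_locally_constant g; apply: filterS => h dh [_ /eqP].
by rewrite dh (negPf d0).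
Qed.

Lemma units_compact : compact (@is_unit A X).
Proof.
have -> : @is_unit A X = unit_arrow @` setT.
  apply/seteqP; split=> g; first by move=> /is_unitE ->; exists (range_of g).
  by move=> [t _ <-].
apply: continuous_compact; last exact: cover_compact.
by apply: continuous_subspaceT; exact: unit_arrow_continuous.
Qed.

Lemma units_closed : closed (@is_unit A X).
Proof.
rewrite -[@is_unit A X]setCK closedC openE => g; exact: nbhs_not_unit.
Qed.

Lemma isotropy_degree0 g : cover_factor (range_of g) = cover_factor (source_of g) ->
  degree g = 0 -> is_unit g.
Proof.
move=> e d0; split=> //; have [i [j [dg es]]] := groupoidP g.
have ij : i = j by lia.
by move: es; rewrite ij => /iter_cover_shift_inj; apply=> m _; rewrite e.
Qed.

(** The equation says that w repeats with period |i - j| from position min(i, j)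
    on, so that the letters before position max(i, j) determine all others. *)
Lemma eventually_periodic_eq (w w' : full_shift A) i j : i <> j ->
  iter i shift w = iter j shift w -> iter i shift w' = iter j shift w' ->
  (forall m, (m < maxn i j)%N -> w m = w' m) -> w = w'.
Proof.
wlog ij : i j / (i < j)%N.
  move=> H n e e' h; have [ij|ji|//] := ltngtP i j; first exact: (H i j).
  by apply: (H j i) => //; [exact: nesym|rewrite maxnC].
move=> _ e e'; rewrite (maxn_idPr (ltnW ij)) => h.
apply: funext => n; elim/ltn_ind: n => n IH.
have [/h//|jn] := ltnP n j.
have E (v : full_shift A) : iter i shift v = iter j shift v -> v n = v (n - (j - i))%N.
  move=> ev; have : iter i shift v (n - j)%N = iter j shift v (n - j)%N by rewrite ev.
  by rewrite !iter_shiftE subnK // => <-; congr (v _); lia.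
by rewrite (E w e) (E w' e') IH //; lia.
Qed.

(** All finer classes of t are nonempty subsets of {x}. *)
Lemma coord_set1 t i x : cover_coord t i = [set x] ->
  forall s, cover_coord s i = cover_coord t i -> s = t.
Proof.
move=> tx s st; apply: cover_ext => N; pose M := maxn N (val i).2.
have iM : index_le i (level M) by apply: index_le_level; exact: leq_maxr.
have NM : index_le (level N) (level M) by apply: level_le; exact: leq_maxl.
have h (r : shift_cover X) : cover_coord r i = [set x] -> cover_coord r (level M) x.
  move=> rx; have ry := coord_rep r (level M).
  by have := coord_down iM ry; rewrite rx => <-.
by rewrite (coord_le NM (h s _)) ?st// (coord_le NM (h t tx)).
Qed.

(** The points y of X embed densely into the cover, by taking the class of y at
    each index. An open set over a single point x thus contains no other y. *)
Lemma isolated_of_constant_factor (U : set (shift_cover X)) t x : open U -> U t ->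
  (forall u, U u -> cover_factor u = x) ->
  exists2 N, cover_coord t (level N) = [set x] & open [set t].
Proof.
move=> oU Ut Ux; have := open_nbhs_nbhs (conj oU Ut) => /cover_nbhsP[N hN].
have H : cover_coord t (level N) = [set x].
  suff S : cover_coord t (level N) `<=` [set x].
    apply/seteqP; split=> // y ->; have ty := coord_rep t (level N).
    by rewrite -(S _ ty).
  move=> y ty; have Xy := coord_in ty; rewrite /set1 /=.
  (* u is the image of y under the dense embedding of X. *)
  pose c i : past_quotient X i := SigSub (mem_set (imageP (past_class X i) Xy)).
  have cP : cover_set (c : prod_topology _).
    move=> i j ij z /= [Xz sz]; apply: past_class_eq; exact: past_sim_le sz.
  pose u : shift_cover X := SigSub (mem_set cP).
  have uc i : cover_coord u i = past_class X i y by [].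
  have Uu : U u by apply: hN; rewrite uc (coord_class ty).
  rewrite -(Ux _ Uu); apply: funext => n.
  apply: esym; apply: (@cover_factor_coord _ _ u (level n.+1) y) => //=.
exists N => //; rewrite openE => _ ->; apply/cover_nbhsP; exists N => s.
exact: (coord_set1 H).
Qed.

Lemma coord_set1_eq t s N M x : cover_coord t (level N) = [set x] ->
  cover_coord s (level M) = [set x] -> t = s.
Proof.
move=> tx sx; apply: (@coord_set1 _ (level (maxn N M)) x).
  have le := @level_le _ _ (leq_maxr N M).
  apply/seteqP; split=> [y|y ->].
    by move/(coord_down le); rewrite sx.
  have := coord_rep s (level (maxn N M)).
  by move=> /[dup] /(coord_down le); rewrite sx => ->.
have l1 := @level_le _ _ (leq_maxl N M); have l2 := @level_le _ _ (leq_maxr N M).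
have h (r : shift_cover X) K : (K <= maxn N M)%N -> cover_coord r (level K) = [set x] ->
    cover_coord r (level (maxn N M)) = past_class X (level (maxn N M)) x.
  move=> le rx; have ry := coord_rep r (level (maxn N M)).
  by have := coord_down (level_le le) ry; rewrite rx (coord_class ry) => ->.
by rewrite (h t N) ?leq_maxl// (h s M) ?leq_maxr.
Qed.

(** Around an arrow of degree i - j <> 0, all points of X below the two ends
    satisfy sigma^i w = sigma^j w and have the same leading letters. They are one
    and the same point by [eventually_periodic_eq], so both ends of the arrow are
    isolated over it, hence equal. *)
Lemma open_fiber_isotropy g (W : set G) : open W -> W g ->
  (forall h, W h -> cover_factor (range_of h) = cover_factor (source_of h)) ->
  ~ is_unit g -> range_of g = source_of g /\ open [set range_of g].
Proof.
move=> oW Wg WH ng.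
have d0 : degree g <> 0 by move=> d0; apply: ng; apply: isotropy_degree0 => //; exact: WH.
have /groupoid_nbhsP[b [bi [Ug Vg dg eg] hu hv] bW] : nbhs g W by exact: open_nbhs_nbhs.
have [oU oV iU iV eUV] := bi.
have ij : b.2.1 <> b.2.2 by move=> ij; apply: d0; rewrite dg ij subrr.
have arrow (u v : shift_cover X) : b.1.1 u -> b.1.2 v ->
    iter b.2.1 cover_shift u = iter b.2.2 cover_shift v ->
    cover_factor u = cover_factor v.
  move=> Uu Vv e.
  have P : exists i j : nat, degree g = i%:Z - j%:Z /\
    iter i cover_shift u = iter j cover_shift v by exists b.2.1, b.2.2.
  by apply: (WH (Groupoid P)); apply: bW.
have rs := arrow _ _ Ug Vg eg.
have key (u v : shift_cover X) : b.1.1 u -> b.1.2 v ->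
    iter b.2.1 cover_shift u = iter b.2.2 cover_shift v ->
    cover_factor u = cover_factor (range_of g).
  move=> Uu Vv e; have uv := arrow _ _ Uu Vv e.
  apply: (eventually_periodic_eq ij).
  - by rewrite {2}uv -!cover_factor_iter e.
  - by rewrite {2}rs -!cover_factor_iter eg.
  move=> m; rewrite leq_max => /orP[mi|mj]; first exact: hu.
  by rewrite uv rs; exact: hv.
have fU (u : shift_cover X) : b.1.1 u -> cover_factor u = cover_factor (range_of g).
  move=> Uu; have : (iter b.2.1 cover_shift @` b.1.1) (iter b.2.1 cover_shift u) by exists u.
  by rewrite eUV => -[v Vv /esym e]; exact: key e.
have fV (v : shift_cover X) : b.1.2 v -> cover_factor v = cover_factor (range_of g).
  move=> Vv; have : (iter b.2.2 cover_shift @` b.1.2) (iter b.2.2 cover_shift v) by exists v.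
  by rewrite -eUV => -[u Uu e]; rewrite -(arrow u v) //; exact: key e.
have [N rN o1] := isolated_of_constant_factor oU Ug fU.
have [M sM _] := isolated_of_constant_factor oV Vg fV.
by split=> //; exact: coord_set1_eq rN sM.
Qed.

Lemma arrow_open g : open [set range_of g] -> open [set source_of g] -> open [set g].
Proof.
move=> oR oS; rewrite openE => _ ->; rewrite /interior.
have : nbhs g (@range_of A X @^-1` [set range_of g] `&`
   (@source_of A X @^-1` [set source_of g] `&` [set h | degree h = degree g])).
  apply: filterI; first by apply: range_continuous; exact: open_nbhs_nbhs.
  apply: filterI; first by apply: source_continuous; exact: open_nbhs_nbhs.
  exact: degree_locally_constant.
by apply: filterS => h [/= hr [/= hs hd]]; exact: groupoid_eq.
Qed.

Definition isotropy t : set G := [set g | range_of g = t /\ source_of g = t].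

Lemma isotropy_closed t : closed (isotropy t).
Proof.
have -> : isotropy t = @range_of A X @^-1` [set t] `&` @source_of A X @^-1` [set t] by [].
apply: closedI; apply: preimage_closed => //; try exact: cover_set1_closed.
  by move=> g _; exact: range_continuous.
by move=> g _; exact: source_continuous.
Qed.

Lemma isotropy_open t (S : set G) : open [set t] -> S `<=` isotropy t -> open S.
Proof.
move=> ot St; rewrite openE => g Sg; have [r s] := St _ Sg.
apply: (@filterS _ _ _ [set g]); first by move=> _ ->.
by apply: open_nbhs_nbhs; split=> //; apply: arrow_open; rewrite ?r ?s.
Qed.

Lemma isotropy_subset_closed t (S : set G) : open [set t] -> S `<=` isotropy t -> closed S.
Proof.
move=> ot St.
have -> : S = isotropy t `&` ~` (isotropy t `\` S).
  apply/seteqP; split=> g; first by move=> Sg; split; [exact: St|case].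
  by move=> [it h]; apply: contrapT => nS; apply: h.
apply: closedI; first exact: isotropy_closed.
by rewrite closedC; apply: (isotropy_open ot) => g [].
Qed.

(** Over an isolated point the isotropy group is closed and discrete. *)
Lemma compact_isotropy_finite t (K : set G) : open [set t] -> compact K ->
  finite_set (K `&` isotropy t).
Proof.
move=> ot cK.
have : compact (K `&` isotropy t).
  by apply: compact_closedI => //; exact: isotropy_closed.
move=> /compact_near_coveringP.
pose F := filter_from (@finite_set G) (fun D => [set E | finite_set E /\ D `<=` E]).
have FF : Filter F.
  apply: filter_from_filter; first by exists set0.
  move=> D E fD fE; exists (D `|` E); first by rewrite finite_setU.
  by move=> S [fS]; rewrite subUset => -[DS ES].
move=> /(_ _ F (fun E g => E g) FF) [|D fD hD]; last first.
  have h := hD D (conj fD (@subset_refl _ D)); exact: sub_finite_set h fD.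
move=> g [_ ig]; exists ([set g], [set E | finite_set E /\ [set g] `<=` E]).
  split=> /=; last by exists [set g] => //; exact: finite_set1.
  by apply: open_nbhs_nbhs; split=> //; apply: (isotropy_open ot) => _ ->.
by move=> [h E] /= [-> [_]]; apply.
Qed.

End GroupoidTopology.

(** * Complex moduli *)

Notation modulus := (@ComplexField.Normc.normc _).

Section Modulus.
Variable R : realType.
Implicit Types z w : R[i].

Lemma normr_modulus z : `|z| = (modulus z)%:C%C.
Proof. by []. Qed.

Lemma modulus_ge0 z : 0 <= modulus z.
Proof. rewrite -lecR -normr_modulus; exact: (normr_ge0 z). Qed.

Lemma modulusD z w : modulus (z + w) <= modulus z + modulus w.
Proof. exact: le_normcD. Qed.

Lemma modulusN z : modulus (- z) = modulus z.
Proof. exact: normcN. Qed.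

Lemma modulusB z w : modulus (z - w) = modulus (w - z).
Proof. by rewrite -modulusN opprB. Qed.

Lemma modulus_tri z w v : modulus (z - v) <= modulus (z - w) + modulus (w - v).
Proof. by rewrite -[z - v](subrKA w); exact: modulusD. Qed.

Lemma modulusM z w : modulus (z * w) = modulus z * modulus w.
Proof. exact: ComplexField.Normc.normcM. Qed.

Lemma modulus0 : modulus (0 : R[i]) = 0.
Proof. exact: ComplexField.Normc.normc0. Qed.

Lemma modulus_le0 z : modulus z <= 0 -> z = 0.
Proof.
move=> h; apply: ComplexField.Normc.eq0_normc.
by apply/le_anti; rewrite h modulus_ge0.
Qed.

Lemma modulus_le_limit z (M : R) :
  (forall e : R, 0 < e -> modulus z <= M * e) -> z = 0.
Proof.
move=> h; apply: modulus_le0; apply/ler_addgt0Pl => e e0; rewrite addr0.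
have [M0|M0] := leP M 0.
  by apply: le_trans (h 1 ltr01) _; rewrite mulr1 (le_trans M0)// ltW.
by have := h (e / M) (divr_gt0 e0 M0); rewrite mulrC divfK // gt_eqF.
Qed.

Lemma modulus_Re z : `|complex.Re z| <= modulus z.
Proof. by rewrite -lecR -normr_modulus; exact: normc_ge_Re. Qed.

Lemma modulus_Im z : `|complex.Im z| <= modulus z.
Proof.
have := modulus_Re (- 'i%C * z); rewrite modulusM modulusN.
have -> : modulus ('i%C : R[i]) = 1.
  by rewrite /ComplexField.Normc.normc /= expr0n /= add0r expr1n sqrtr1.
by rewrite mul1r; case: z => a b /=; rewrite oppr0 mul0r !mulN1r opprK add0r.
Qed.

Lemma modulus_ReIm z : modulus z <= `|complex.Re z| + `|complex.Im z|.
Proof.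
have -> : z = (complex.Re z)%:C%C + 'i%C * (complex.Im z)%:C%C.
  by case: z => a b /=; simpc.
apply: le_trans (modulusD _ _) _; rewrite modulusM.
have -> : modulus ('i%C : R[i]) = 1.
  by rewrite /ComplexField.Normc.normc /= expr0n /= add0r expr1n sqrtr1.
have E (x : R) : modulus x%:C%C = `|x|.
  by rewrite /ComplexField.Normc.normc /= expr0n /= addr0 sqrtr_sqr.
by rewrite mul1r !E; case: z => a b /=; simpc.
Qed.

Lemma modulus_nbhs z (U : set R[i]^o) : nbhs (z : R[i]^o) U <->
  exists2 e : R, 0 < e & forall w, modulus (w - z) < e -> U w.
Proof.
split.
  move/nbhs_normP => -[e e0 h]; exists (complex.Re e).
    by move: e0; rewrite /= ltcE => /andP[].
  move=> w hw; apply: h; rewrite /= distrC normr_modulus.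
  have -> : e = (complex.Re e)%:C%C.
    by move: e0; rewrite /= ltcE; case: (e) => a b /= /andP[/eqP ->].
  by rewrite ltcR.
move=> [e e0 h]; apply: (@nbhs_normP _ R[i]^o (z : R[i]^o) U).2.
exists e%:C%C; first by rewrite /= ltcR.
by move=> w /=; rewrite distrC normr_modulus ltcR; exact: h.
Qed.

Lemma modulus_continuousP (T : topologicalType) (f : T -> R[i]^o) x :
  {for x, continuous f} <->
  forall e : R, 0 < e -> \forall y \near x, modulus (f y - f x) < e.
Proof.
split=> [cf e e0|h U /modulus_nbhs[e e0 hU]].
  suff /cf : nbhs (f x) [set w : R[i]^o | modulus (w - f x) < e] by [].
  by apply/modulus_nbhs; exists e.
by move: (h e e0); apply: filterS => y; exact: hU.
Qed.

End Modulus.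

Lemma near_eq_continuous (T U : topologicalType) (f k : T -> U) x :
  (\forall y \near x, f y = k y) -> {for x, continuous k} -> {for x, continuous f}.
Proof.
move=> fk ck W; rewrite (nbhs_singleton fk) => /ck.
by apply: filterS2 fk => y; rewrite /preimage /= => ->.
Qed.

(** * Compactly supported functions and their convolution *)

Section CompactlySupported.
Variables (R : realType) (A : finType) (X : shift_space A).
Local Notation G := (groupoid X).
Local Notation C := (R[i]^o).
Implicit Types (f k : G -> C) (g : G) (t s : shift_cover X) (h : shift_cover X -> C).

Lemma Cc_subsupport f k : Cc f -> continuous k -> (forall g, k g != 0 -> f g != 0) ->
  Cc k.
Proof.
move=> [_ cf] ck kf; split=> //; apply: subclosed_compact cf _.
  exact: closed_closure.
by apply: closure_subset => g; exact: kf.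
Qed.

Lemma Cc0 : Cc (0 : G -> C).
Proof.
split; first exact: cst_continuous.
rewrite (_ : [set g | _] = set0) ?closure0; first exact: compact0.
by apply/seteqP; split=> // g /=; rewrite eqxx.
Qed.

Lemma CcD f k : Cc f -> Cc k -> Cc (f + k).
Proof.
move=> [cf sf] [ck sk]; split; first by move=> g; apply: continuousD; [exact: cf|exact: ck].
have : compact (closure [set g | f g != 0] `|` closure [set g | k g != 0]) by exact: compactU.
move/subclosed_compact; apply; first exact: closed_closure.
rewrite -closureU; apply: closure_subset => g /=.
apply: contraPP => /not_orP[/negP + /negP]; rewrite !negbK => /eqP f0 /eqP k0 /=.
have -> : (f + k) g = f g + k g by [].
by rewrite f0 k0 addr0 eqxx.
Qed.

Lemma CcZ (c : R[i]) f : Cc f -> Cc (c *: f).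
Proof.
move=> cf; apply: (Cc_subsupport cf).
  move=> g; apply: (@continuousM _ _ (fun=> c)); [exact: cst_continuous|exact: cf.1].
by move=> g; apply: contra => /eqP f0; have -> : (c *: f) g = c * f g by []; rewrite f0 mulr0.
Qed.

Lemma CcN f : Cc f -> Cc (- f).
Proof. by move=> cf; rewrite -scaleN1r; exact: CcZ. Qed.

Lemma CcB f k : Cc f -> Cc k -> Cc (f - k).
Proof. by move=> cf ck; apply: CcD => //; exact: CcN. Qed.

Lemma Cc_mull h f : continuous h -> Cc f -> Cc (fun g => h (range_of g) * f g : C).
Proof.
move=> ch cf; apply: (Cc_subsupport cf).
  move=> g; apply: (@continuousM _ _ (fun g => h (range_of g))); last exact: cf.1.
  by apply: continuous_comp; [exact: range_continuous|exact: ch].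
by move=> g; apply: contra => /eqP ->; rewrite mulr0.
Qed.

Lemma Cc_mulr h f : continuous h -> Cc f -> Cc (fun g => f g * h (source_of g) : C).
Proof.
move=> ch cf; apply: (Cc_subsupport cf).
  move=> g; apply: (@continuousM _ _ f (fun g => h (source_of g))); first exact: cf.1.
  by apply: continuous_comp; [exact: source_continuous|exact: ch].
by move=> g; apply: contra => /eqP ->; rewrite mul0r.
Qed.

Lemma extend_unitsE h g : is_unit g -> extend_units h g = h (range_of g).
Proof. by move=> ug; rewrite /extend_units asboolT. Qed.

Lemma extend_unitsN h g : ~ is_unit g -> extend_units h g = 0.
Proof. by move=> ug; rewrite /extend_units asboolF. Qed.

(** The unit space is closed, open and compact in the groupoid. *)
Lemma Cc_extend h : continuous h -> Cc (extend_units h).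
Proof.
move=> ch; split.
  move=> g; have [ug|ug] := pselect (is_unit g).
    apply: (@near_eq_continuous _ _ _ (fun g => h (range_of g))).
      by move: (nbhs_is_unit ug); apply: filterS => g'; exact: extend_unitsE.
    by apply: continuous_comp; [exact: range_continuous|exact: ch].
  apply: (@near_eq_continuous _ _ _ (fun=> 0)); last exact: cst_continuous.
  by move: (nbhs_not_unit ug); apply: filterS => g'; exact: extend_unitsN.
apply: subclosed_compact (@units_compact _ X) _; first exact: closed_closure.
rewrite [X in _ `<=` X](closure_id _).1; last exact: units_closed.
apply: closure_subset => g /=; apply: contraPP => ug.
by rewrite extend_unitsN // eqxx.
Qed.

(** The isotropy group of t embeds into the integers by the degree; for isolated
    t these functions are the Laurent polynomials in a generator of its image. *)
Definition isotropic t f := finite_set [set g | f g != 0] /\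
  forall g, f g != 0 -> isotropy t g.

Lemma isotropic_Cc t f : open [set t] -> isotropic t f -> Cc f.
Proof.
move=> ot [fin sub]; split.
  move=> g; have [ig|ig] := pselect (isotropy t g).
    apply: (@near_eq_continuous _ _ _ (fun=> f g)); last exact: cst_continuous.
    apply: (@filterS _ _ _ [set g]); first by move=> _ ->.
    by apply: open_nbhs_nbhs; split=> //; apply: (isotropy_open ot) => _ ->.
  apply: (@near_eq_continuous _ _ _ (fun=> 0)); last exact: cst_continuous.
  apply: (@filterS _ _ _ (~` isotropy t)).
    by move=> g' ng; apply/eqP; apply: contrapT => /negP /sub.
  by apply: open_nbhs_nbhs; split=> //; apply: closed_openC; exact: isotropy_closed.
rewrite -(closure_id _).1; last exact: (isotropy_subset_closed ot).
exact: finite_compact.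
Qed.

Lemma convolution_sum f k g (S : {fset (G * G)}) :
  (forall ab, ab \in S -> is_product ab.1 ab.2 g) ->
  (forall a b, is_product a b g -> f a != 0 -> k b != 0 -> (a, b) \in S) ->
  convolution f k g = \sum_(ab <- S) f ab.1 * k ab.2.
Proof.
move=> Sg hS; rewrite /convolution.
rewrite -(fsbig_widen [set` S] [set ab | is_product ab.1 ab.2 g]) => [|ab /= /Sg//|].
  by rewrite [RHS]fsbig_seq // fset_uniq.
move=> [a b] [/= gab nS]; apply/eqP; apply: contrapT => /negP; rewrite mulf_eq0 negb_or.
by move=> /andP[fa kb]; apply: nS; exact: hS.
Qed.

Lemma convolution1 f k g a b : is_product a b g ->
  (forall a' b', is_product a' b' g -> f a' != 0 -> k b' != 0 -> (a', b') = (a, b)) ->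
  convolution f k g = f a * k b.
Proof.
move=> gab u; rewrite (@convolution_sum _ _ _ [fset (a, b)]%fset).
- by rewrite big_seq_fset1.
- by move=> ab; rewrite in_fset1 => /eqP ->.
- by move=> a' b' p fa kb; rewrite in_fset1 (u a' b').
Qed.

Lemma product_unitl g : is_product (unit_arrow (range_of g)) g g.
Proof. by split=> //=; rewrite add0r. Qed.

Lemma product_unitr g : is_product g (unit_arrow (source_of g)) g.
Proof. by split=> //=; rewrite addr0. Qed.

Lemma product_cancell a b b' g : is_product a b g -> is_product a b' g -> b = b'.
Proof.
move=> [s1 _ s2 d] [s1' _ s2' d']; apply: groupoid_eq; last by rewrite -s2 -s2'.
  by rewrite -s1.
by apply: (addrI (degree a)); rewrite -d -d'.
Qed.

Lemma product_cancelr a a' b g : is_product a b g -> is_product a' b g -> a = a'.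
Proof.
move=> [s1 r1 _ d] [s1' r1' _ d']; apply: groupoid_eq; first by rewrite -r1 -r1'.
  by apply: (addIr (degree b)); rewrite -d -d'.
by rewrite s1 s1'.
Qed.

Lemma convolution_extendl h f g :
  convolution (extend_units h) f g = h (range_of g) * f g.
Proof.
rewrite (convolution1 (product_unitl g)) ?extend_unitsE//.
move=> a b p ha _; have ua : is_unit a.
  by apply: contrapT => na; move: ha; rewrite extend_unitsN ?eqxx.
have ea : a = unit_arrow (range_of g) by rewrite (is_unitE ua); case: p => _ -> _ _.
by rewrite ea in p *; rewrite (product_cancell p (product_unitl g)).
Qed.

Lemma convolution_extendr h f g :
  convolution f (extend_units h) g = f g * h (source_of g).
Proof.
rewrite (convolution1 (product_unitr g)) ?extend_unitsE//.
move=> a b p _ hb; have ub : is_unit b.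
  by apply: contrapT => nb; move: hb; rewrite extend_unitsN ?eqxx.
have eb : b = unit_arrow (source_of g).
  by rewrite (is_unitE ub) ub.1; case: p => _ _ -> _.
by rewrite eb in p *; rewrite (product_cancelr p (product_unitr g)).
Qed.

End CompactlySupported.

(** * Real-valued norms *)

(** Applied both to scalars in R and to scalars in R[i], for which the rate has
    to be an argument. *)
Lemma complete_rate (K : numFieldType) (V : completeNormedModType K)
    (u : nat -> V) (r : nat -> K) :
  (forall n, 0 < r n) ->
  (forall e, 0 < e -> exists N, forall n, (N <= n)%N -> r n <= e) ->
  (forall n m, `|u n - u m| <= r n + r m) ->
  exists l, forall n, `|u n - l| <= r n *+ 3.
Proof.
move=> r0 rl ur.
have : cvg (u @ \oo).
  apply: cauchy_cvg; apply: cauchy_exP => e e0.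
  have [N hN] := rl (e / 3) (divr_gt0 e0 (ltr0n _ 3)).
  exists (u N); exists N => // n Nn; rewrite /= -ball_normE /=.
  apply: le_lt_trans (ur _ _) _.
  apply: (@le_lt_trans _ _ (e / 3 + e / 3)); first by apply: lerD; apply: hN.
  have {3}-> : e = e / 3 + e / 3 + e / 3 by field.
  by rewrite ltrDl divr_gt0.
move=> /cvg_ex[l ul]; exists l => n.
have /cvgrPdist_le/(_ _ (r0 n)) ul' := ul.
have [N hN] := rl _ (r0 n).
have nN : \forall m \near \oo, r m <= r n by exists N.
have [m [/= h1 h2]] := filter_ex (filterI ul' nN).
have -> : u n - l = (u n - u m) + (u m - l) by rewrite addrA subrK.
apply: le_trans (ler_normD _ _) _.
rewrite mulrS mulr2n addrA; apply: lerD; last by rewrite distrC.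
by apply: le_trans (ur _ _) _; rewrite lerD2l.
Qed.

Lemma harmonic_rate (R : realType) (e : R) : 0 < e ->
  exists N, forall n, (N <= n)%N -> n.+1%:R^-1 <= e.
Proof.
move=> e0; have [N _ hN] := near_infty_natSinv_lt (PosNum e0).
by exists N => n Nn; apply: ltW; exact: hN.
Qed.

Section Norm.
Variables (R : realType) (V : completeNormedModType R[i]).
Implicit Types a b : V.

(** The norms of spaces over R[i] are elements of R[i] with zero imaginary part. *)
Definition nrm a : R := complex.Re `|a|.

Lemma nrmE a : `|a| = (nrm a)%:C%C.
Proof.
have := normr_ge0 a; rewrite /nrm lecE; case: `|a| => x y /= /andP[/eqP ->].
by [].
Qed.

Lemma nrm_ge0 a : 0 <= nrm a.
Proof. by rewrite -lecR -nrmE; exact: normr_ge0. Qed.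

Lemma nrmD a b : nrm (a + b) <= nrm a + nrm b.
Proof. by rewrite -lecR rmorphD /= -!nrmE; exact: ler_normD. Qed.

Lemma nrmN a : nrm (- a) = nrm a.
Proof. by rewrite /nrm normrN. Qed.

Lemma nrmB a b : nrm (a - b) = nrm (b - a).
Proof. by rewrite -nrmN opprB. Qed.

Lemma nrm_tri a b c : nrm (a - c) <= nrm (a - b) + nrm (b - c).
Proof. by rewrite -[a - c](subrKA b); exact: nrmD. Qed.

Lemma nrm0 : nrm (0 : V) = 0.
Proof. by rewrite /nrm normr0. Qed.

Lemma nrmZ (c : R[i]) a : nrm (c *: a) = modulus c * nrm a.
Proof.
by apply: complexI; rewrite rmorphM /= -!nrmE normrZ normr_modulus.
Qed.

Lemma nrm_le0 a : nrm a <= 0 -> a = 0.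
Proof.
move=> h; apply/eqP; rewrite -normr_eq0 nrmE; apply/eqP.
by congr (_%:C%C); apply/le_anti; rewrite h nrm_ge0.
Qed.

Lemma nrm_small a (M : R) : (forall e, 0 < e -> nrm a <= M * e) -> a = 0.
Proof.
move=> h; apply: nrm_le0; apply/ler_addgt0Pl => e e0; rewrite addr0.
have [M0|M0] := leP M 0.
  by apply: le_trans (h 1 ltr01) _; rewrite mulr1 (le_trans M0)// ltW.
by have := h (e / M) (divr_gt0 e0 M0); rewrite mulrC divfK // gt_eqF.
Qed.

Lemma nrm_complete (u : nat -> V) :
  (forall n m, nrm (u n - u m) <= n.+1%:R^-1 + m.+1%:R^-1) ->
  exists l, forall n, nrm (u n - l) <= n.+1%:R^-1 *+ 3.
Proof.
move=> h; have [||n m|l hl] := @complete_rate _ V u (fun n => (n.+1%:R^-1 : R)%:C%C).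
- by move=> n; rewrite ltcR invr_gt0 ltr0n.
- move=> e e0; have e0' : 0 < complex.Re e by move: e0; rewrite ltcE => /andP[].
  have [N hN] := harmonic_rate e0'; exists N => n /hN hn.
  have -> : e = (complex.Re e)%:C%C.
    by move: e0; rewrite ltcE; case: (e) => a b /= /andP[/eqP ->].
  by rewrite lecR.
- by rewrite nrmE -rmorphD lecR.
by exists l => n; have := hl n; rewrite nrmE -rmorphMn lecR.
Qed.

End Norm.

Section CStarLemmas.
Variables (R : realType) (O : cstarAlgType R).
Implicit Types a b c : O.

Lemma nrm_cmul a b : nrm (cmul a b) <= nrm a * nrm b.
Proof. by rewrite -lecR rmorphM /= -!nrmE; exact: cnormM. Qed.

Lemma cmulNl a b : cmul (- a) b = - cmul a b.
Proof. by rewrite -scaleN1r cmulZl scaleN1r. Qed.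

Lemma cmulNr a b : cmul a (- b) = - cmul a b.
Proof. by rewrite -scaleN1r cmulZr scaleN1r. Qed.

Lemma cmulBl a b c : cmul (a - b) c = cmul a c - cmul b c.
Proof. by rewrite cmulDl cmulNl. Qed.

Lemma cmulBr a b c : cmul a (b - c) = cmul a b - cmul a c.
Proof. by rewrite cmulDr cmulNr. Qed.

End CStarLemmas.

(** * The norm of the regular representations *)

Section RegularRepresentation.
Variables (R : realType) (A : finType) (X : shift_space A).
Local Notation G := (groupoid X).
Local Notation C := (R[i]^o).
Implicit Types (f k xi : G -> C) (g : G) (t s : shift_cover X).

(** For nonnegative c this bounds [l2norm] by c, without extended reals ([l2normP]). *)
Definition l2bounded t xi (c : R) : Prop := forall S : {fset G},
  (forall g, g \in S -> source_of g = t) ->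
  \sum_(g <- S) modulus (xi g) ^+ 2 <= c ^+ 2.

Lemma l2normP t xi (c : R) : 0 <= c -> (l2norm t xi <= c%:E)%E <-> l2bounded t xi c.
Proof.
move=> c0; rewrite /l2norm.
set E := (\esum_(g in _) _)%E.
have E0 : (0 <= E)%E by apply: esum_ge0 => g _; rewrite lee_fin sqr_ge0.
have H : (E `^ 2^-1 <= c%:E)%E <-> (E <= (c ^+ 2)%:E)%E.
  rewrite poweR12_sqrt //; case: E E0 => [r|//|//] r0 /=; rewrite !lee_fin.
  rewrite lee_fin in r0; split=> h.
    by rewrite -(sqr_sqrtr r0) ler_pXn2r // nnegrE ?sqrtr_ge0.
  by rewrite -(ger0_norm c0) -sqrtr_sqr ler_sqrt // sqr_ge0.
apply: (iff_trans H); split=> [h S hS|h].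
  rewrite -lee_fin; apply: le_trans h; apply: ereal_sup_ubound.
  exists [set` S]; first by split=> // g /= /hS.
  by rewrite -sumEFin [RHS]fsbig_seq // fset_uniq.
apply: ge_ereal_sup => _ [F [fF FS] <-].
rewrite fsumEFin // lee_fin (fsbig_fwiden (fset_set F)) //.
- by apply: h => g; rewrite in_fset_set // => /set_mem /FS.
- by move=> g Fg /=; rewrite in_fset_set //; exact: mem_set.
- by move=> g [/=]; rewrite in_fset_set // => /set_mem.
Qed.

Lemma l2bounded1 t xi c g : l2bounded t xi c -> source_of g = t -> 0 <= c ->
  modulus (xi g) <= c.
Proof.
move=> h gt c0; rewrite -(@ler_pXn2r _ 2) ?nnegrE ?modulus_ge0 //.
by have := h [fset g]%fset; rewrite big_seq_fset1; apply => g'; rewrite in_fset1 => /eqP ->.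
Qed.

Lemma l2bounded_mono t xi xi' c : (forall g, modulus (xi' g) <= modulus (xi g)) ->
  l2bounded t xi c -> l2bounded t xi' c.
Proof.
move=> le h S hS; apply: le_trans (h S hS); apply: ler_sum => g _.
by rewrite ler_pXn2r // nnegrE modulus_ge0.
Qed.

Definition supp xi : set G := [set g | xi g != 0].

Lemma convolution_finite xi g : finite_set (supp xi) ->
  exists S : {fset (G * G)}, (forall ab, ab \in S -> is_product ab.1 ab.2 g) /\
    forall f, convolution f xi g = \sum_(ab <- S) f ab.1 * xi ab.2.
Proof.
move=> fin; pose P := \bigcup_(b in supp xi)
  [set ab : G * G | is_product ab.1 ab.2 g /\ ab.2 = b].
have fP : finite_set P.
  apply: bigcup_finite => // b _.
  have [[a p]|np] := pselect (exists a, is_product a b g).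
    apply: (@sub_finite_set _ _ [set (a, b)]); last exact: finite_set1.
    by move=> [a' b'] /= [p' e]; subst b'; rewrite (product_cancelr p' p).
  rewrite (_ : [set ab | _] = set0); first exact: finite_set0.
  by apply/seteqP; split=> // -[a' b'] /= [p' e]; subst b'; apply: np; exists a'.
exists (fset_set P); split=> [ab|f].
  by rewrite in_fset_set // => /set_mem[b _ []].
apply: convolution_sum => [ab|a b p _ xb].
  by rewrite in_fset_set // => /set_mem[b _ []].
by rewrite in_fset_set //; apply: mem_set; exists b.
Qed.

Lemma convolutionB f k xi g : finite_set (supp xi) ->
  convolution (f - k) xi g = convolution f xi g - convolution k xi g.
Proof.
move=> /(@convolution_finite _ g)[S [_ h]]; rewrite !h -sumrB.
by apply: eq_bigr => ab _; rewrite -mulrBl.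
Qed.

Lemma convolution_small xi g : finite_set (supp xi) -> exists2 M : R, 0 <= M &
  forall f (e : R), (forall g, modulus (f g) <= e) -> modulus (convolution f xi g) <= M * e.
Proof.
move=> /(@convolution_finite _ g)[S [_ h]].
exists (\sum_(ab <- S) modulus (xi ab.2)).
  by apply: sumr_ge0 => ab _; exact: modulus_ge0.
move=> f e fe; rewrite h mulr_suml.
elim/big_ind2: _ => [|x a y b xa yb|ab _].
- by rewrite modulus0.
- by apply: le_trans (modulusD _ _) _; exact: lerD.
by rewrite modulusM mulrC; apply: ler_wpM2l; [exact: modulus_ge0|exact: fe].
Qed.

Variable O : shift_algebra R X.

Lemma embedB f k : Cc f -> Cc k -> embed O (f - k) = embed O f - embed O k.
Proof.
by move=> cf ck; rewrite embedD //; [rewrite -scaleN1r embedZ // scaleN1r|exact: CcN].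
Qed.

Lemma embed0 : embed O 0 = 0.
Proof. by have := embedZ O 0 (@Cc0 R _ X); rewrite !scale0r. Qed.

Lemma nrm_embed f : Cc f -> (nrm (embed O f))%:E = reduced_norm f.
Proof. exact: embed_norm. Qed.

Lemma regular_rep_bounded f t xi : Cc f -> l2bounded t xi 1 ->
  l2bounded t (convolution f xi) (nrm (embed O f)).
Proof.
move=> cf /(l2normP _ _ ler01) h; apply/l2normP; first exact: nrm_ge0.
rewrite nrm_embed //; apply: (@le_trans _ _ (regular_rep_norm t f)).
  by apply: ereal_sup_ubound; exists xi.
by apply: ereal_sup_ubound; right; exists t.
Qed.

(** Convolution by f sends the point mass at the source of g to a vector with
    the value f g at g. *)
Lemma value_le_nrm f g : Cc f -> modulus (f g) <= nrm (embed O f).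
Proof.
move=> cf; pose h (s : shift_cover X) : C := (s == source_of g)%:R.
have b1 : l2bounded (source_of g) (extend_units h) 1.
  move=> S hS; rewrite expr1n; pose u := unit_arrow (source_of g).
  have E (k : G) : k \in S -> k != u -> extend_units h k = 0.
    move=> /hS ks ku; apply: extend_unitsN => uk; move: ku.
    by rewrite (is_unitE uk) uk.1 ks eqxx.
  have [uS|uS] := boolP (u \in S).
    rewrite (big_fsetD1 u) //= big_seq big1 ?addr0.
      rewrite extend_unitsE // /h /= eqxx; rewrite /ComplexField.Normc.normc /=.
      by rewrite expr1n expr0n addr0 sqrtr1 expr1n.
    by move=> k; rewrite in_fsetD1 => /andP[ku kS]; rewrite E // modulus0 expr0n.
  rewrite big_seq big1 ?ler01 // => k kS; rewrite E ?modulus0 ?expr0n //.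
  by apply: contraNneq uS => <-.
have := l2bounded1 (regular_rep_bounded cf b1) (erefl (source_of g)) (nrm_ge0 _).
by rewrite convolution_extendr /h eqxx mulr1.
Qed.

(** Finitely many values of the convolution f * xi only depend on finitely many
    values of xi, as every value is either a finite sum or 0 by convention. So
    vectors of finite support compute the norm. *)
Lemma nrm_embed_le f (c : R) : Cc f -> 0 <= c ->
  (forall t xi, finite_set (supp xi) -> l2bounded t xi 1 ->
     l2bounded t (convolution f xi) c) ->
  nrm (embed O f) <= c.
Proof.
move=> cf c0 h; rewrite -lee_fin nrm_embed //.
apply: ge_ereal_sup => _ [->|[t _ <-]]; first by rewrite lee_fin.
apply: ge_ereal_sup => _ [xi hxi <-]; apply/l2normP => // S hS.
have {}hxi : l2bounded t xi 1 by apply/l2normP.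
(* P g: the pairs that contribute at g; B: the arrows at which xi is read. *)
pose P g := [set ab : G * G | is_product ab.1 ab.2 g] `&`
  (fun ab => f ab.1 * xi ab.2) @^-1` [set~ 0].
pose Q g := if `[< finite_set (P g) >] then snd @` P g else set0.
pose B := \bigcup_(g in [set` S]) Q g.
have fB : finite_set B.
  apply: bigcup_finite; first exact: finite_fset.
  move=> g _; rewrite /Q; case: asboolP => fP; last exact: finite_set0.
  exact: finite_image.
pose xi' : G -> C := fun g => if `[< B g >] then xi g else 0.
have fxi' : finite_set (supp xi').
  apply: sub_finite_set fB => g; rewrite /supp /xi' /=.
  by case: asboolP => // _; rewrite eqxx.
have b' : l2bounded t xi' 1.
  apply: l2bounded_mono hxi => g; rewrite /xi'.
  by case: asboolP => // _; rewrite modulus0 modulus_ge0.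
apply: le_trans (h t xi' fxi' b' S hS).
rewrite big_seq [leRHS]big_seq; apply: ler_sum => g gS.
rewrite ler_pXn2r // ?nnegrE ?modulus_ge0 //.
have [fP|iP] := pselect (finite_set (P g)); last first.
  have -> : convolution f xi g = 0 by apply: fsbig_dflt.
  by rewrite modulus0 modulus_ge0.
suff -> : convolution f xi g = convolution f xi' g by [].
apply: eq_fsbigr => -[a b] /set_mem p /=; rewrite /xi'.
case: asboolP => // nB; rewrite mulr0; apply: contrapT => fx.
by apply: nB; exists g => //; rewrite /Q asboolT //; exists (a, b).
Qed.

End RegularRepresentation.

(** * The coefficient functions of elements of the algebra *)

Section Coefficients.
Variables (R : realType) (A : finType) (X : shift_space A) (O : shift_algebra R X).
Local Notation G := (groupoid X).
Local Notation C := (R[i]^o).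
Implicit Types (f k xi : G -> C) (g : G) (t s : shift_cover X) (h : shift_cover X -> C)
  (a b : O).

Lemma Cc_approx a (e : R) : 0 < e -> exists2 f, Cc f & nrm (a - embed O f) <= e.
Proof.
move=> e0; have := @embed_dense _ _ _ O => /seteqP[_ /(_ a Logic.I)].
move=> /(_ [set b | nrm (a - b) <= e]) [].
  apply: (@nbhs_normP _ _ a _).2; exists e%:C%C; first by rewrite /= ltcR.
  by move=> b /=; rewrite nrmE ltcR => /ltW.
by move=> _ [[f cf <-] h]; exists f.
Qed.

(** The pointwise limit of elements of Cc that tend to a; by [coefP] the default
    value 0 never occurs. *)
Definition coef a g : R[i] :=
  xget 0 [set c | forall f, Cc f -> modulus (f g - c) <= nrm (a - embed O f)].

Lemma embed_value_diff f k g : Cc f -> Cc k ->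
  modulus (f g - k g) <= nrm (embed O f - embed O k).
Proof.
move=> cf ck; rewrite -embedB //.
by have := @value_le_nrm _ _ _ O (f - k) g (CcB cf ck).
Qed.

(** By [value_le_nrm], the values at g of any sequence in Cc that tends to a form
    a Cauchy sequence. *)
Lemma coefP a g f : Cc f -> modulus (f g - coef a g) <= nrm (a - embed O f).
Proof.
suff [c hc] : exists c : R[i], forall f, Cc f -> modulus (f g - c) <= nrm (a - embed O f).
  by rewrite /coef; case: xgetP => [_ -> |/(_ c) //]; apply.
have /choice[u hu] : forall n : nat, exists f : G -> C,
    Cc f /\ nrm (a - embed O f) <= n.+1%:R^-1.
  move=> n; have [|k ck hk] := @Cc_approx a n.+1%:R^-1; last by exists k.
  by rewrite invr_gt0 ltr0n.
have cu n : Cc (u n) by have [] := hu n.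
have du n : nrm (a - embed O (u n)) <= n.+1%:R^-1 by have [] := hu n.
have uu n m : modulus (u n g - u m g) <= n.+1%:R^-1 + m.+1%:R^-1.
  apply: le_trans (embed_value_diff g (cu n) (cu m)) _.
  apply: le_trans (nrm_tri _ a _) _; apply: lerD => //.
  by rewrite nrmB.
have r0 n : 0 < (n.+1%:R^-1 : R) by rewrite invr_gt0 ltr0n.
have [|x hx] := complete_rate r0 (@harmonic_rate R) (u := fun n => complex.Re (u n g)).
  move=> n m; apply: le_trans (uu n m).
  by rewrite -raddfB; exact: modulus_Re.
have [|y hy] := complete_rate r0 (@harmonic_rate R) (u := fun n => complex.Im (u n g)).
  move=> n m; apply: le_trans (uu n m).
  by rewrite -raddfB; exact: modulus_Im.
exists (x +i* y)%C => k ck; apply/ler_addgt0Pl => e e0.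
have [N /(_ _ (leqnn N)) hN] := harmonic_rate (divr_gt0 e0 (ltr0n _ 7)).
apply: le_trans (modulus_tri _ (u N g) _) _.
have h1 : modulus (k g - u N g) <= N.+1%:R^-1 + nrm (a - embed O k).
  apply: le_trans (embed_value_diff g ck (cu N)) _.
  apply: le_trans (nrm_tri _ a _) _; rewrite addrC; apply: lerD => //.
  by rewrite nrmB.
have h2 : modulus (u N g - (x +i* y)%C) <= N.+1%:R^-1 *+ 6.
  apply: le_trans (modulus_ReIm _) _; rewrite !raddfB /=.
  by rewrite (_ : 6 = 3 + 3)%N // mulrnDr; apply: lerD; [exact: hx|exact: hy].
apply: le_trans (lerD h1 h2) _.
have : N.+1%:R^-1 * 7 <= e by rewrite -ler_pdivlMr ?ltr0n.
rewrite -[_ *+ 6]mulr_natr => h7.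
by rewrite addrAC lerD2r -[X in X + _]mulr1 -mulrDr.
Qed.

Lemma coef_unique a g (c : R[i]) (K : R) :
  (forall e : R, 0 < e -> exists f, [/\ Cc f, nrm (a - embed O f) <= e &
      modulus (f g - c) <= K * e]) -> coef a g = c.
Proof.
move=> H; apply/eqP; rewrite -subr_eq0; apply/eqP.
apply: (@modulus_le_limit _ _ (1 + K)) => e /H[f [cf fe fc]].
apply: le_trans (modulus_tri _ (f g) _) _; rewrite mulrDl mul1r; apply: lerD => //.
by rewrite modulusB; exact: le_trans (coefP a g cf) fe.
Qed.

Lemma coef_embed f g : Cc f -> coef (embed O f) g = f g.
Proof.
move=> cf; apply/eqP; rewrite eq_sym -subr_eq0; apply/eqP; apply: modulus_le0.
by apply: le_trans (coefP _ g cf) _; rewrite subrr nrm0.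
Qed.

Lemma coefZ (c : R[i]) a g : coef (c *: a) g = c * coef a g.
Proof.
apply: (@coef_unique _ _ _ (modulus c + 1)) => e e0.
have e1 : 0 < e / (modulus c + 1) by rewrite divr_gt0 // ltr_wpDl ?modulus_ge0.
have [f cf fe] := Cc_approx a e1; exists (c *: f).
have le : modulus c * (e / (modulus c + 1)) <= e.
  rewrite mulrCA ger_pMr // ler_pdivrMr ?mul1r ?lerDl //.
  by rewrite ltr_wpDl ?modulus_ge0.
have le2 : modulus c * nrm (a - embed O f) <= e.
  by apply: le_trans le; apply: ler_wpM2l => //; exact: modulus_ge0.
split; first exact: CcZ.
  by rewrite embedZ // -scalerBr nrmZ.
have -> : (c *: f) g - c * coef a g = c * (f g - coef a g) by rewrite mulrBr.
rewrite modulusM; apply: (@le_trans _ _ e).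
  apply: le_trans le2; apply: ler_wpM2l; [exact: modulus_ge0|exact: coefP].
apply: ler_peMl; first exact: ltW.
by rewrite lerDr; exact: modulus_ge0.
Qed.

Lemma coefD a b g : coef (a + b) g = coef a g + coef b g.
Proof.
apply: (@coef_unique _ _ _ 1) => e e0.
have e2 : 0 < e / 2 by rewrite divr_gt0.
have [f cf fe] := Cc_approx a e2; have [k ck ke] := Cc_approx b e2.
have ee : e = e / 2 + e / 2 by field.
exists (f + k); split; first exact: CcD.
  rewrite embedD // opprD addrACA ee.
  by apply: le_trans (nrmD _ _) _; exact: lerD.
have -> : (f + k) g - (coef a g + coef b g) = (f g - coef a g) + (k g - coef b g).
  by rewrite addrACA -opprD.
rewrite mul1r ee; apply: le_trans (modulusD _ _) _; apply: lerD.
  exact: le_trans (coefP _ _ cf) fe.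
exact: le_trans (coefP _ _ ck) ke.
Qed.

Lemma coefB a b g : coef (a - b) g = coef a g - coef b g.
Proof. by rewrite coefD -scaleN1r coefZ mulN1r. Qed.

(** Coefficients of the image under a bounded operator T are obtained from the
    action S of T on Cc by approximation. *)
Lemma coef_bounded_op (T : O -> O) (S : (G -> C) -> G -> C) a g (K : R) (c : R[i]) :
  0 <= K ->
  (forall f, Cc f -> Cc (S f) /\ T (embed O f) = embed O (S f)) ->
  (forall b, nrm (T a - T b) <= K * nrm (a - b)) ->
  (forall f, Cc f -> modulus (S f g - c) <= K * nrm (a - embed O f)) ->
  coef (T a) g = c.
Proof.
move=> K0 TS TK Sc; apply: (@coef_unique _ _ _ 1) => e e0.
have e1 : 0 < e / (K + 1) by rewrite divr_gt0 // ltr_wpDl.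
have le : K * (e / (K + 1)) <= e.
  rewrite mulrCA ger_pMr // ler_pdivrMr ?mul1r ?lerDl //.
  by rewrite ltr_wpDl.
have [f cf fe] := Cc_approx a e1; have [cS ES] := TS f cf; exists (S f); split=> //.
  rewrite -ES; apply: le_trans (TK _) _; apply: le_trans le; exact: ler_wpM2l.
rewrite mul1r; apply: le_trans (Sc _ cf) _; apply: le_trans le; exact: ler_wpM2l.
Qed.

Definition diag h : O := embed O (extend_units h).

Lemma diag_bound h t : continuous h -> modulus (h t) <= nrm (diag h).
Proof.
move=> ch; have := @value_le_nrm _ _ _ O _ (unit_arrow t) (Cc_extend ch).
by rewrite extend_unitsE.
Qed.

Lemma coef_diag h g : continuous h -> coef (diag h) g = extend_units h g.
Proof. by move=> ch; apply: coef_embed; exact: Cc_extend. Qed.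

Lemma coef_diagl h a g : continuous h ->
  coef (cmul (diag h) a) g = h (range_of g) * coef a g.
Proof.
move=> ch; apply: (@coef_bounded_op (cmul (diag h))
  (fun f g => h (range_of g) * f g) _ _ (nrm (diag h))).
- exact: nrm_ge0.
- move=> f cf; split; first exact: Cc_mull.
  rewrite -embedM //; last exact: Cc_extend.
  by congr embed; apply: funext => g'; exact: convolution_extendl.
- by move=> b; rewrite -cmulBr; exact: nrm_cmul.
move=> f cf; rewrite -mulrBr modulusM.
by apply: ler_pM; [exact: modulus_ge0|exact: modulus_ge0|exact: diag_bound|exact: coefP].
Qed.

Lemma coef_diagr h a g : continuous h ->
  coef (cmul a (diag h)) g = coef a g * h (source_of g).
Proof.
move=> ch; apply: (@coef_bounded_op (fun a => cmul a (diag h))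
  (fun f g => f g * h (source_of g)) _ _ (nrm (diag h))).
- exact: nrm_ge0.
- move=> f cf; split; first exact: Cc_mulr.
  rewrite -embedM //; last exact: Cc_extend.
  by congr embed; apply: funext => g'; exact: convolution_extendr.
- by move=> b; rewrite -cmulBl mulrC; exact: nrm_cmul.
move=> f cf; rewrite -mulrBl modulusM mulrC.
by apply: ler_pM; [exact: modulus_ge0|exact: modulus_ge0|exact: diag_bound|exact: coefP].
Qed.

(** A uniform limit of continuous functions, by [coefP]. *)
Lemma coef_continuous a : continuous (coef a : G -> C).
Proof.
move=> g; apply/modulus_continuousP => e e0.
have e3 : 0 < e / 3 by rewrite divr_gt0.
have [f cf fe] := Cc_approx a e3.
have /modulus_continuousP/(_ _ e3) := cf.1 g; apply: filterS => k hk.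
have E : e = e / 3 + (e / 3 + e / 3) by field.
apply: le_lt_trans (modulus_tri _ (f k) _) _; rewrite E.
apply: ler_ltD; first by rewrite modulusB; exact: le_trans (coefP _ _ cf) fe.
apply: le_lt_trans (modulus_tri _ (f g) _) _; apply: ltr_leD => //.
exact: le_trans (coefP _ _ cf) fe.
Qed.

Lemma small_values_l2 f xi (K : {fset G}) : finite_set (supp xi) ->
  exists2 M : R, 0 <= M & forall k (e : R), (forall g, modulus (k g) <= e) ->
    \sum_(g <- K) modulus (convolution k xi g) ^+ 2 <= M * e ^+ 2.
Proof.
move=> fx.
have /choice[M hM] : forall g, exists m : R, 0 <= m /\
    forall k (e : R), (forall g, modulus (k g) <= e) ->
      modulus (convolution k xi g) <= m * e.
  by move=> g; have [m m0 hm] := convolution_small g fx; exists m.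
exists (\sum_(g <- K) M g ^+ 2); first by apply: sumr_ge0 => g _; exact: sqr_ge0.
move=> k e ke; rewrite mulr_suml; apply: ler_sum => g _.
have [M0 hk] := hM g; rewrite -exprMn.
have := hk k e ke => le; rewrite ler_pXn2r // nnegrE; first exact: modulus_ge0.
exact: le_trans (modulus_ge0 _) le.
Qed.

(** The regular representations are faithful on the completion. If f is within e
    of a, then f is within 2 e of elements k of Cc whose values are uniformly as
    small as desired, because the coefficients of a vanish. Such k act negligibly
    on a given vector of finite support, which bounds the norm of f by 3 e. *)
Lemma coef_inj a : (forall g, coef a g = 0) -> a = 0.
Proof.
move=> a0; apply: (@nrm_small _ _ _ 4) => e e0.
have [f cf fe] := Cc_approx a e0.
suff fle : nrm (embed O f) <= 3 * e.
  rewrite -[a](subrK (embed O f)); apply: le_trans (nrmD _ _) _.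
  apply: le_trans (lerD fe fle) _; lra.
have e3 : 0 <= 3 * e by rewrite mulr_ge0 // ltW.
apply: nrm_embed_le => // t xi fx bx S hS.
have [M M0 hM] := small_values_l2 f S fx.
(* This choice of d yields both d <= e and 2 M d^2 <= e^2. *)
pose d := Num.min e (e / (1 + 2 * M)).
have M1 : 0 < 1 + 2 * M by rewrite ltr_pwDl // mulr_ge0.
have d0 : 0 < d by rewrite lt_min e0 divr_gt0.
have de : d <= e by rewrite ge_min lexx.
have dM : (1 + 2 * M) * d <= e by rewrite mulrC -ler_pdivlMr // ge_min lexx orbT.
have [k ck ke] := Cc_approx a d0.
have kd g : modulus (k g) <= d.
  by have := coefP a g ck; rewrite a0 subr0 => h; exact: le_trans h ke.
have fk : nrm (embed O (f - k)) <= 2 * e.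
  rewrite embedB //; apply: le_trans (nrm_tri _ a _) _; rewrite nrmB.
  by apply: le_trans (lerD fe (le_trans ke de)) _; lra.
have := regular_rep_bounded O (CcB cf ck) bx hS.
have := hM k d kd.
set Sk := \sum_(g <- S) _; set Sd := \sum_(g <- S) _ => hk hd.
have hd' : Sd <= (2 * e) ^+ 2.
  apply: le_trans hd _; rewrite ler_pXn2r // nnegrE ?nrm_ge0 //.
  by rewrite mulr_ge0 // ltW.
apply: (@le_trans _ _ (2 * Sd + 2 * Sk)).
  rewrite !mulr_sumr -big_split /=; apply: ler_sum => g _.
  have E : convolution f xi g = convolution (f - k) xi g + convolution k xi g.
    by rewrite convolutionB // subrK.
  have le := modulusD (convolution (f - k) xi g) (convolution k xi g).
  rewrite -E in le.
  set u := modulus (convolution (f - k) xi g) in le *.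
  set v := modulus (convolution k xi g) in le *.
  have := modulus_ge0 (convolution f xi g).
  set w := modulus (convolution f xi g) in le * => w0.
  have := sqr_ge0 (u - v); nra.
have : 2 * Sk <= e ^+ 2.
  have : 2 * M * d ^+ 2 <= e ^+ 2 by nra.
  by nra.
nra.
Qed.

(** The coefficients of a on the units define a continuous function h, and then
    [coef_inj] identifies a with the image of h. *)
Lemma units_in_diagonal a : (forall g, ~ is_unit g -> coef a g = 0) ->
  exists2 h, continuous h & a = diag h.
Proof.
move=> ha; pose h t : C := coef a (unit_arrow t).
have ch : continuous h.
  move=> t; apply: (@continuous_comp _ _ _ (@unit_arrow A X) (coef a : G -> C)).
    exact: unit_arrow_continuous.
  exact: coef_continuous.
exists h => //; apply/eqP; rewrite -subr_eq0; apply/eqP; apply: coef_inj => g.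
rewrite coefB coef_diag //; have [ug|ug] := pselect (is_unit g).
  by rewrite extend_unitsE // /h -(is_unitE ug) subrr.
by rewrite extend_unitsN // ha // subr0.
Qed.

End Coefficients.

(** * Points of the unit circle near 1 *)

Section Circle.
Variable R : realType.
Implicit Types z : R[i].

(** The quotient (m + i) / (m - i), which tends to 1 as m grows. *)
Definition circle_point (m : nat) : R[i] :=
  ((m%:R ^+ 2 - 1) / (m%:R ^+ 2 + 1) +i* (2 * m%:R / (m%:R ^+ 2 + 1)))%C.

Lemma sqr1_gt0 (m : nat) : 0 < m%:R ^+ 2 + 1 :> R.
Proof. by rewrite ltr_wpDl // sqr_ge0. Qed.

Lemma circle_point_modulus m : modulus (circle_point m) = 1.
Proof.
rewrite /ComplexField.Normc.normc /circle_point.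
have := sqr1_gt0 m; set r : R := m%:R => h; have {}h : r ^+ 2 + 1 != 0 by rewrite gt_eqF.
by rewrite (_ : _ + _ = 1) ?sqrtr1 //; field.
Qed.

Lemma circle_point_near1 m : modulus (1 - circle_point m.+1) <= 4 * m.+1%:R^-1.
Proof.
apply: le_trans (modulus_ReIm _) _; rewrite !raddfB /=.
have h := sqr1_gt0 m.+1; have r1 : 1 <= m.+1%:R :> R by rewrite ler1n.
set r : R := m.+1%:R in h r1 *; have h0 : r ^+ 2 + 1 != 0 by rewrite gt_eqF.
have -> : 1 - (r ^+ 2 - 1) / (r ^+ 2 + 1) = 2 / (r ^+ 2 + 1) by field.
have r0 : 0 < r by apply: lt_le_trans r1.
have p1 : 0 <= 2 / (r ^+ 2 + 1) by rewrite divr_ge0 // ltW.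
have p2 : 0 <= 2 * r / (r ^+ 2 + 1) by rewrite divr_ge0 ?mulr_ge0 // ltW.
rewrite sub0r normrN !ger0_norm //.
rewrite -mulrDl ler_pdivrMr // mulrAC ler_pdivlMr //; nra.
Qed.

Lemma circle_point_inj : injective circle_point.
Proof.
move=> m n /(congr1 (@complex.Re R)) /=.
have hm := lt0r_neq0 (sqr1_gt0 m); have hn := lt0r_neq0 (sqr1_gt0 n).
move/eqP; rewrite eqr_div // => /eqP e.
have : (m%:R : R) ^+ 2 = n%:R ^+ 2 by lra.
by move/eqP; rewrite eqrXn2 ?ler0n // => /eqP /(mulrIn (oner_neq0 _)).
Qed.

(** Infinitely many points of the circle are near 1, and at most n of them are
    n-th roots of unity. *)
Lemma circle_near1_nonroot (n : nat) (e : R) : (0 < n)%N -> 0 < e ->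
  exists z, [/\ modulus z = 1, modulus (1 - z) <= e & z ^+ n != 1].
Proof.
move=> n0 e0; have [N hN] := harmonic_rate (divr_gt0 e0 (ltr0n R 4)).
apply: contrapT => H.
have root m : (N <= m)%N -> circle_point m.+1 ^+ n = 1.
  move=> Nm; apply/eqP; apply: contrapT => /negP hz; apply: H.
  exists (circle_point m.+1); split=> //; first exact: circle_point_modulus.
  apply: le_trans (circle_point_near1 m) _.
  by rewrite mulrC -ler_pdivlMr ?ltr0n //; exact: hN.
pose rs := [seq circle_point m | m <- iota N.+1 n.+1].
have : (size rs <= n)%N.
  apply: (@max_unity_roots _ n rs) => //.
    apply/allP => _ /mapP[m + ->]; rewrite mem_iota => /andP[Nm _].
    by case: m Nm => // m Nm; rewrite unity_rootE root.
  by rewrite map_inj_uniq ?iota_uniq //; exact: circle_point_inj.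
by rewrite size_map size_iota ltnn.
Qed.

Lemma modulus_expn z n : modulus z = 1 -> modulus (z ^+ n) = 1.
Proof.
move=> z1; elim: n => [|n IH]; first exact: ComplexField.Normc.normc1.
by rewrite exprS modulusM z1 IH mulr1.
Qed.

Lemma modulus_exprz z (n : int) : modulus z = 1 -> modulus (z ^ n) = 1.
Proof.
move=> z1; case: n => n; first exact: modulus_expn.
by rewrite NegzE -invr_expz ComplexField.Normc.normcV modulus_expn // invr1.
Qed.

Lemma modulus_1subX z (n : nat) : modulus z = 1 ->
  modulus (1 - z ^+ n) <= n%:R * modulus (1 - z).
Proof.
move=> z1; elim: n => [|n IH]; first by rewrite expr0 subrr modulus0 mul0r.
have -> : 1 - z ^+ n.+1 = (1 - z) + z * (1 - z ^+ n) by rewrite exprS; ring.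
apply: le_trans (modulusD _ _) _; rewrite modulusM z1 mul1r -natr1 mulrDl mul1r addrC.
by rewrite lerD2r.
Qed.

Lemma modulus_1subXz z (n : int) : modulus z = 1 ->
  modulus (1 - z ^ n) <= `|n|%N%:R * modulus (1 - z).
Proof.
move=> z1; case: n => n; first exact: modulus_1subX.
have zn0 : z ^+ n.+1 != 0.
  apply/eqP => z0; have := modulus_expn n.+1 z1; rewrite z0 modulus0.
  by move/eqP; rewrite eq_sym oner_eq0.
have -> : 1 - z ^ Negz n = - (z ^ Negz n * (1 - z ^+ n.+1)).
  by rewrite NegzE -invr_expz -exprnP mulrBr mulr1 mulVf // opprB.
by rewrite modulusN modulusM modulus_exprz // mul1r; exact: modulus_1subX.
Qed.

End Circle.

(** * Commuting idempotents *)

Section Idempotents.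
Variables (R : realType) (O : cstarAlgType R).
Implicit Types a b p q : O.

Lemma cmul_close a b a' b' (e : R) : nrm (a - a') <= e -> nrm (b - b') <= e -> e <= 1 ->
  nrm (cmul a b - cmul a' b') <= (nrm a + nrm b + 1) * e.
Proof.
move=> ha hb e1; have e0 : 0 <= e by apply: le_trans ha; exact: nrm_ge0.
have b'1 : nrm b' <= nrm b + 1.
  rewrite -[b'](subrK b) addrC; apply: le_trans (nrmD _ _) _; rewrite lerD2l.
  by rewrite nrmB; exact: le_trans hb e1.
have -> : cmul a b - cmul a' b' = cmul a (b - b') + cmul (a - a') b'.
  by rewrite cmulBr cmulBl addrA subrK.
apply: le_trans (nrmD _ _) _; rewrite -addrA mulrDl; apply: lerD.
  apply: le_trans (nrm_cmul _ _) _; apply: ler_wpM2l => //; exact: nrm_ge0.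
apply: le_trans (nrm_cmul _ _) _; rewrite mulrC.
by apply: ler_pM => //; exact: nrm_ge0.
Qed.

(** The difference d of commuting idempotents satisfies d^3 = d, so that its
    norm is 0 or at least 1. *)
Lemma close_commuting_idempotents p q : cmul p p = p -> cmul q q = q ->
  cmul p q = cmul q p -> nrm (p - q) < 1 -> p = q.
Proof.
move=> pp qq pq lt1; pose d := p - q.
have ppq : cmul p (cmul p q) = cmul p q by rewrite cmulA pp.
have qpq : cmul q (cmul p q) = cmul p q by rewrite pq cmulA qq.
have d3 : cmul d (cmul d d) = d.
  have -> : cmul d d = p - cmul p q - (cmul p q - q).
    by rewrite /d cmulBl !cmulBr pp qq -pq.
  rewrite /d cmulBl !cmulBr pp ppq qpq qq -pq.
  by rewrite !subrr subr0 sub0r opprK addrA subrK.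
have : nrm d <= nrm d * (nrm d * nrm d).
  rewrite -{1}d3; apply: le_trans (nrm_cmul _ _) _; apply: ler_wpM2l; first exact: nrm_ge0.
  exact: nrm_cmul.
have := nrm_ge0 d; rewrite -/d in lt1 => d0 le3.
apply/eqP; rewrite -subr_eq0; apply/eqP; apply: nrm_le0; rewrite -/d.
by nra.
Qed.

End Idempotents.

(** * The gauge action *)

Section Gauge.
Variables (R : realType) (A : finType) (X : shift_space A) (O : shift_algebra R X).
Local Notation G := (groupoid X).
Local Notation C := (R[i]^o).
Implicit Types (f k xi : G -> C) (g : G) (t s x : shift_cover X) (z : R[i]).

(** The action of the circle dual to the grading of the groupoid by the degree. *)
Definition gauge z f : G -> C := fun g => z ^ degree g * f g.

Lemma modulus_gauge z f g : modulus z = 1 -> modulus (gauge z f g) = modulus (f g).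
Proof. by move=> z1; rewrite modulusM modulus_exprz // mul1r. Qed.

Lemma unimodular_neq0 z : modulus z = 1 -> z != 0.
Proof.
by move=> z1; apply/eqP => z0; move/eqP: z1; rewrite z0 modulus0 eq_sym oner_eq0.
Qed.

Lemma unimodular_inv z : modulus z = 1 -> modulus z^-1 = 1.
Proof. by move=> z1; rewrite ComplexField.Normc.normcV z1 invr1. Qed.

Lemma gaugeK z f : modulus z = 1 -> gauge z (gauge z^-1 f) = f.
Proof.
move=> z1; apply: funext => g; rewrite /gauge mulrA exprz_inv.
by rewrite -expfzDr ?unimodular_neq0 // subrr expr0z mul1r.
Qed.

Lemma gaugeVK z f : modulus z = 1 -> gauge z^-1 (gauge z f) = f.
Proof.
by move=> z1; rewrite -{2}[z]invrK gaugeK // unimodular_inv.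
Qed.

Lemma gaugeB z f k : gauge z (f - k) = gauge z f - gauge z k.
Proof. by apply: funext => g; rewrite /gauge mulrBr. Qed.

Lemma gauge_convolution z f k : modulus z = 1 ->
  convolution (gauge z f) (gauge z k) = gauge z (convolution f k).
Proof.
move=> z1; apply: funext => g; rewrite /gauge /convolution mulr_fsumr.
apply: eq_fsbigr => -[a b] /set_mem[_ _ _ /= ->].
by rewrite expfzDr ?unimodular_neq0 // mulrACA.
Qed.

Lemma supp_gauge z f : modulus z = 1 -> supp (gauge z f) = supp f.
Proof.
move=> z1; apply/seteqP; split=> g; rewrite /supp /= mulf_eq0 negb_or.
  by case/andP.
by move=> ->; rewrite expfz_neq0 ?unimodular_neq0.
Qed.

Lemma l2bounded_gauge z t xi c : modulus z = 1 ->
  l2bounded t xi c -> l2bounded t (gauge z xi) c.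
Proof. by move=> z1; apply: l2bounded_mono => g; rewrite modulus_gauge. Qed.

(** The gauge action is isometric on vectors and multiplicative for convolution,
    so it conjugates the operators of convolution by f and by its image. *)
Lemma gauge_isometry z f : modulus z = 1 -> Cc f -> Cc (gauge z f) ->
  nrm (embed O (gauge z f)) = nrm (embed O f).
Proof.
suff H z' f' : modulus z' = 1 -> Cc f' -> Cc (gauge z' f') ->
    nrm (embed O (gauge z' f')) <= nrm (embed O f').
  move=> z1 cf cg; apply/le_anti; rewrite H //= -{1}(gaugeVK f z1).
  by apply: H; rewrite ?gaugeVK // unimodular_inv.
move=> z1 cf cg; apply: nrm_embed_le => //; first exact: nrm_ge0.
move=> t xi fx bx; rewrite -(gaugeK xi z1) gauge_convolution //.
apply: l2bounded_gauge => //; apply: regular_rep_bounded => //.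
by apply: l2bounded_gauge => //; exact: unimodular_inv.
Qed.

Lemma isotropic_gauge z x f : modulus z = 1 -> isotropic x f -> isotropic x (gauge z f).
Proof.
move=> z1 [fin sub]; have e := supp_gauge f z1; split.
  by rewrite -/(supp _) e.
by move=> g; have : supp (gauge z f) g -> supp f g by [rewrite e]; move=> h /h /sub.
Qed.

Lemma isotropicB x f k : isotropic x f -> isotropic x k -> isotropic x (f - k).
Proof.
move=> [ff fs] [kf ks].
have H g : (f - k) g != 0 -> f g != 0 \/ k g != 0.
  move=> h; apply: contrapT => /not_orP[/negP + /negP].
  rewrite !negbK => /eqP f0 /eqP k0; move: h.
  have -> : (f - k) g = f g - k g by [].
  by rewrite f0 k0 subrr eqxx.
split; last by move=> g /H[/fs|/ks].
by apply: (@sub_finite_set _ _ (supp f `|` supp k)) => [g /H//|]; rewrite finite_setU.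
Qed.

Lemma convolution_neq0 f k g : convolution f k g != 0 ->
  exists a b, [/\ is_product a b g, f a != 0 & k b != 0].
Proof.
move=> h; apply: contrapT => H; move/eqP: h; apply; apply: fsbig1 => -[a b] /= p.
apply/eqP; apply: contrapT => /negP; rewrite mulf_eq0 negb_or => /andP[fa kb].
by apply: H; exists a, b.
Qed.

Lemma isotropic_convolution x f k : isotropic x f -> isotropic x k ->
  isotropic x (convolution f k).
Proof.
move=> [ff fs] [kf ks]; split; last first.
  move=> g /convolution_neq0[a [b [[_ rg sg _] /fs[ra _] /ks[_ sb]]]].
  by split; [rewrite rg|rewrite sg].
pose P (ab : G * G) : set G := [set g | is_product ab.1 ab.2 g].
apply: (@sub_finite_set _ _ (\bigcup_(ab in supp f `*` supp k) P ab)).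
  by move=> g /convolution_neq0[a [b [p fa kb]]]; exists (a, b).
apply: bigcup_finite; first exact: finite_setX.
move=> [a b] _; have [[g0 p]|np] := pselect (exists g, P (a, b) g).
  apply: (@sub_finite_set _ _ [set g0]); last exact: finite_set1.
  move=> g p'; apply: groupoid_eq.
  - by case: p p' => _ -> _ _ [_ -> _ _].
  - by case: p p' => _ _ _ -> [_ _ _ ->].
  - by case: p p' => _ _ -> _ [_ _ -> _].
rewrite (_ : P _ = set0); first exact: finite_set0.
by apply/seteqP; split=> // g p; apply: np; exists g.
Qed.

(** The degree embeds the isotropy group into the integers. *)
Lemma isotropic_convolutionC x f k : isotropic x f -> isotropic x k ->
  convolution f k = convolution k f.
Proof.
move=> [_ fs] [_ ks]; apply: funext => g.
pose Q := [set ab : G * G | is_product ab.1 ab.2 g /\ isotropy x ab.1 /\ isotropy x ab.2].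
have widen f' k' : (forall a, f' a != 0 -> isotropy x a) ->
    (forall a, k' a != 0 -> isotropy x a) ->
    convolution f' k' g = \sum_(ab \in Q) f' ab.1 * k' ab.2.
  move=> f's k's; apply/esym/fsbig_widen => [ab []//|[a b] [/= p nQ]].
  apply/eqP; apply: contrapT => /negP; rewrite mulf_eq0 negb_or => /andP[fa kb].
  by apply: nQ; split=> //; split; [exact: f's|exact: k's].
rewrite !widen //; pose h (ab : G * G) := (ab.2, ab.1).
have hQ ab : Q ab -> Q (h ab).
  case: ab => a b [[/= s1 s2 s3 d] [[ra sa] [rb sb]]]; split=> /=.
    by split; rewrite ?s2 ?s3 ?ra ?sa ?rb ?sb ?d // addrC.
  by split.
rewrite (@reindex_fsbig _ _ _ _ _ h Q Q).
  by apply: eq_fsbigr => ab _; rewrite mulrC.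
split=> [ab /hQ //|[a b] [a' b'] _ _ [-> ->] //|ab Qab].
by exists (h ab); [exact: hQ|case: ab Qab].
Qed.

Definition point_mass g : G -> C := fun g' => (g' == g)%:R.

Lemma isotropic_point_mass x g : isotropy x g -> isotropic x (point_mass g).
Proof.
move=> ig; have H g' : point_mass g g' != 0 -> g' = g.
  by rewrite /point_mass; case: (eqVneq g' g) => // _ /eqP.
split; last by move=> g' /H ->.
by apply: (@sub_finite_set _ _ [set g]); [exact: H|exact: finite_set1].
Qed.

Lemma nrm_isotropic_le x f (S : {fset G}) : open [set x] ->
  (forall g, g \in S -> isotropy x g) -> (forall g, f g != 0 -> g \in S) ->
  nrm (embed O f) <= \sum_(g <- S) modulus (f g) * nrm (embed O (point_mass g)).
Proof.
move=> ox Sx fS.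
have H (r : seq G) (c : G -> R[i]) : (forall g, g \in r -> isotropy x g) ->
   Cc (\sum_(g <- r) c g *: (point_mass g : G -> C)) /\
   nrm (embed O (\sum_(g <- r) c g *: point_mass g)) <=
     \sum_(g <- r) modulus (c g) * nrm (embed O (point_mass g)).
  elim: r => [|g r IH] hr.
    by rewrite !big_nil embed0 nrm0; split=> //; exact: Cc0.
  have [|c1 le1] := IH; first by move=> g' g'r; apply: hr; rewrite inE g'r orbT.
  have cg : Cc (point_mass g : G -> C).
    by apply: (isotropic_Cc ox); apply: isotropic_point_mass; apply: hr; rewrite inE eqxx.
  rewrite !big_cons; split; first by apply: CcD => //; exact: CcZ.
  rewrite embedD //; last exact: CcZ.
  rewrite embedZ //; apply: le_trans (nrmD _ _) _.
  by rewrite nrmZ lerD2l.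
have [_] := H S f Sx.
suff -> : \sum_(g <- S) f g *: point_mass g = f by [].
apply: funext => g; rewrite fct_sumE.
have [gS|gS] := boolP (g \in S).
  rewrite (big_fsetD1 g) //= big_seq big1 ?addr0.
    have -> : (f g *: point_mass g) g = f g * (g == g)%:R by [].
    by rewrite eqxx mulr1.
  move=> g'; rewrite in_fsetD1 => /andP[ng _].
  have -> : (f g' *: point_mass g') g = f g' * (g == g')%:R by [].
  by rewrite eq_sym (negPf ng) mulr0.
rewrite big_seq big1.
  by apply/esym/eqP; apply: contraNT gS; exact: fS.
move=> g' g'S; have -> : (f g' *: point_mass g') g = f g' * (g == g')%:R by [].
by case: eqVneq g'S => [<-|_ _]; [rewrite (negPf gS)|rewrite mulr0].
Qed.

(** On the isotropy group, f is a finite sum of point masses, and a point mass of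
    degree n is moved by |1 - z^n| <= |n| |1 - z|. *)
Lemma gauge_near1 x f : open [set x] -> isotropic x f -> exists2 K : R, 0 <= K &
  forall z, modulus z = 1 -> nrm (embed O f - embed O (gauge z f)) <= K * modulus (1 - z).
Proof.
move=> ox ix; have [fin sub] := ix.
pose S := fset_set (supp f).
have inS g : (g \in S) = (f g != 0).
  by rewrite in_fset_set //; apply/idP/idP => [/set_mem|/mem_set].
pose K : R := \sum_(g <- S) `|degree g|%N%:R * (modulus (f g) * nrm (embed O (point_mass g))).
exists K; first by apply: sumr_ge0 => g _; rewrite !mulr_ge0 ?modulus_ge0 ?nrm_ge0.
move=> z z1; have ig := isotropic_gauge z1 ix.
rewrite -embedB; [|exact: (isotropic_Cc ox)|exact: (isotropic_Cc ox)].
have E g : (f - gauge z f) g = (1 - z ^ degree g) * f g by rewrite mulrBl mul1r.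
apply: le_trans (@nrm_isotropic_le x _ S ox _ _) _.
- by move=> g; rewrite inS => /sub.
- by move=> g; rewrite E inS; apply: contraNneq => ->; rewrite mulr0.
rewrite mulr_suml; apply: ler_sum => g _; rewrite E modulusM -mulrA [leRHS]mulrAC.
apply: ler_wpM2r; last exact: modulus_1subXz.
by rewrite mulr_ge0 ?modulus_ge0 ?nrm_ge0.
Qed.

End Gauge.

(** * Idempotents over an isolated point *)

Section IsotropicIdempotents.
Variables (R : realType) (A : finType) (X : shift_space A) (O : shift_algebra R X).
Local Notation G := (groupoid X).
Local Notation C := (R[i]^o).
Variable x : shift_cover X.
Hypothesis ox : open [set x].
Implicit Types (f k : G -> C) (g : G) (z : R[i]) (p q : O).

Definition isotropic_limit p := forall e : R, 0 < e ->
  exists2 f, isotropic x f & nrm (p - embed O f) <= e.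

(** The image q of p under the gauge action: as the action is isometric on
    Laurent polynomials, it sends approximations of p to a Cauchy sequence. *)
Lemma gauge_limit p z : isotropic_limit p -> modulus z = 1 ->
  exists q, forall f, isotropic x f -> nrm (q - embed O (gauge z f)) <= nrm (p - embed O f).
Proof.
move=> lp z1.
have /choice[u hu] : forall n : nat, exists f : G -> C,
    isotropic x f /\ nrm (p - embed O f) <= n.+1%:R^-1.
  move=> n; have [|f xf hf] := lp n.+1%:R^-1; last by exists f.
  by rewrite invr_gt0 ltr0n.
have xu n : isotropic x (u n) by have [] := hu n.
have du n : nrm (p - embed O (u n)) <= n.+1%:R^-1 by have [] := hu n.
have iso f k : isotropic x f -> isotropic x k ->
    nrm (embed O (gauge z f) - embed O (gauge z k)) = nrm (embed O f - embed O k).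
  move=> xf xk; have cc f' : isotropic x f' -> Cc f' by exact: isotropic_Cc.
  have cB := cc _ (isotropicB xf xk).
  have cgB := cc _ (isotropic_gauge z1 (isotropicB xf xk)).
  rewrite -embedB; try by apply: cc; exact: isotropic_gauge.
  by rewrite -gaugeB gauge_isometry // embedB //; exact: cc.
have [|q hq] := @nrm_complete _ O (fun n => embed O (gauge z (u n))).
  move=> n m; rewrite iso //; apply: le_trans (nrm_tri _ p _) _; apply: lerD => //.
  by rewrite nrmB.
exists q => f xf; apply/ler_addgt0Pl => e e0.
have [N /(_ _ (leqnn N)) hN] := harmonic_rate (divr_gt0 e0 (ltr0n _ 4)).
apply: le_trans (nrm_tri _ (embed O (gauge z (u N))) _) _.
have h1 : nrm (q - embed O (gauge z (u N))) <= N.+1%:R^-1 *+ 3 by rewrite nrmB.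
have h2 : nrm (embed O (gauge z (u N)) - embed O (gauge z f)) <=
    N.+1%:R^-1 + nrm (p - embed O f).
  rewrite iso //; apply: le_trans (nrm_tri _ p _) _; apply: lerD => //.
  by rewrite nrmB.
apply: le_trans (lerD h1 h2) _; rewrite addrA lerD2r -mulrSr.
by rewrite -[_ *+ 4]mulr_natr -ler_pdivlMr ?ltr0n.
Qed.

Lemma isotropic_limit_le1 p (e : R) : isotropic_limit p -> 0 < e ->
  exists2 f, isotropic x f & nrm (p - embed O f) <= Num.min e 1.
Proof. by move=> lp e0; apply: lp; rewrite lt_min e0 ltr01. Qed.

Lemma min1_scale (K e : R) : 0 <= K -> K * Num.min e 1 <= K * e.
Proof. by move=> K0; apply: ler_wpM2l; rewrite // ge_min lexx. Qed.

(** This is the connectedness of the circle. Limits of Laurent polynomials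
    commute with each other, and the gauge action moves them continuously; so for
    z near 1 the image q of p is an idempotent that commutes with p and is close to
    p, hence q = p by [close_commuting_idempotents]. Comparing the coefficients of
    degree n yields z^n = 1, but some z near 1 are not n-th roots of unity. *)
Lemma isotropic_idempotent p : isotropic_limit p -> cmul p p = p ->
  forall g, degree g != 0 -> coef p g = 0.
Proof.
move=> lp pp g d0; apply: contrapT => /eqP pg.
have cc f : isotropic x f -> Cc f by exact: isotropic_Cc.
(* A Laurent polynomial f0 within 1/8 of p; z will move f0 by at most 1/4, so that
   p and its image are at distance at most 1/8 + 1/4 + 1/8 < 1. *)
have [|f0 xf0 hf0] := lp 8^-1; first by rewrite invr_gt0 ltr0n.
have [K K0 hK] := gauge_near1 O ox xf0.
have nd : (0 < `|degree g|)%N by rewrite absz_gt0.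
have e0 : 0 < (4 * (K + 1))^-1 by rewrite invr_gt0 mulr_gt0 // ltr_wpDl.
have [z [z1 zn1 /negP]] := circle_near1_nonroot nd e0; apply.
have [q hq] := gauge_limit lp z1.
have gxf f : isotropic x f -> isotropic x (gauge z f) by exact: isotropic_gauge.
have qq : cmul q q = q.
  apply/eqP; rewrite -subr_eq0; apply/eqP.
  pose K1 := (nrm q + nrm q + 1) + ((nrm p + nrm p + 1) + 1) + 1.
  have K10 : 0 <= K1 by rewrite !addr_ge0 ?nrm_ge0.
  apply: (@nrm_small _ _ _ K1) => e e1.
  have [f xf m1] := isotropic_limit_le1 lp e1.
  apply: le_trans (min1_scale _ K10); set e' := Num.min e 1 in m1 *.
  have e'1 : e' <= 1 by rewrite ge_min lexx orbT.
  have mq := le_trans (hq f xf) m1.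
  have h1 := cmul_close mq mq e'1; have h2 := cmul_close m1 m1 e'1.
  rewrite pp in h2.
  have h3 : nrm (cmul (embed O (gauge z f)) (embed O (gauge z f)) - embed O (gauge z f)) <=
      (nrm p + nrm p + 1) * e' + e'.
    rewrite -embedM ?gauge_convolution //; try by apply: cc; exact: gxf.
    have xff := isotropic_convolution xf xf.
    rewrite -embedB; try by apply: cc; exact: gxf.
    rewrite -gaugeB gauge_isometry //; first last.
    - by apply: cc; apply: gxf; exact: isotropicB.
    - by apply: cc; exact: isotropicB.
    have cf := cc _ xf; have cff := cc _ xff.
    rewrite embedB // embedM //.
    by apply: le_trans (nrm_tri _ p _) _; apply: lerD => //; rewrite nrmB.
  apply: le_trans (nrm_tri _ (cmul (embed O (gauge z f)) (embed O (gauge z f))) _) _.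
  rewrite /K1 -addrA mulrDl; apply: lerD => //.
  apply: le_trans (nrm_tri _ (embed O (gauge z f)) _) _.
  by rewrite !mulrDl mul1r; apply: lerD; [rewrite !mulrDl mul1r in h3|rewrite nrmB].
have pq : cmul p q = cmul q p.
  apply/eqP; rewrite -subr_eq0; apply/eqP.
  pose K1 := (nrm p + nrm q + 1) + (nrm q + nrm p + 1).
  have K10 : 0 <= K1 by rewrite !addr_ge0 ?nrm_ge0.
  apply: (@nrm_small _ _ _ K1) => e e1.
  have [f xf m1] := isotropic_limit_le1 lp e1.
  apply: le_trans (min1_scale _ K10); set e' := Num.min e 1 in m1 *.
  have e'1 : e' <= 1 by rewrite ge_min lexx orbT.
  have mq := le_trans (hq f xf) m1.
  apply: le_trans (nrm_tri _ (cmul (embed O f) (embed O (gauge z f))) _) _.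
  rewrite /K1 mulrDl; apply: lerD; first exact: cmul_close.
  have cf := cc _ xf; have cgf := cc _ (gxf _ xf).
  rewrite -embedM // (isotropic_convolutionC xf (gxf _ xf)) embedM //.
  by rewrite nrmB; exact: cmul_close.
have coefq : coef q g = z ^ degree g * coef p g.
  apply/eqP; rewrite -subr_eq0; apply/eqP; apply: (@modulus_le_limit _ _ 2) => e e1.
  have [f xf hf] := lp e e1.
  apply: le_trans (modulus_tri _ (gauge z f g) _) _; rewrite mulr_natl mulr2n; apply: lerD.
    rewrite modulusB; apply: le_trans (coefP q g (cc _ (gxf _ xf))) _.
    exact: le_trans (hq f xf) hf.
  rewrite /gauge -mulrBr modulusM modulus_exprz // mul1r.
  exact: le_trans (coefP p g (cc _ xf)) hf.
have near : nrm (p - q) < 1.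
  apply: le_lt_trans (nrm_tri _ (embed O (gauge z f0)) _) _.
  have h1 : nrm (embed O (gauge z f0) - q) <= 8^-1.
    by rewrite nrmB; exact: le_trans (hq _ xf0) hf0.
  have h2 : nrm (p - embed O (gauge z f0)) <= 8^-1 + 4^-1.
    apply: le_trans (nrm_tri _ (embed O f0) _) _; apply: lerD => //.
    apply: le_trans (hK z z1) _; apply: (@le_trans _ _ ((K + 1) * (4 * (K + 1))^-1)).
      by apply: ler_pM => //; [exact: modulus_ge0|rewrite lerDl].
    have K1 : K + 1 != 0 by rewrite gt_eqF // ltr_wpDl.
    by rewrite invfM mulrCA divff // mulr1.
  by apply: le_lt_trans (lerD h2 h1) _; lra.
have e := close_commuting_idempotents pp qq pq near.
rewrite -e in coefq; apply/eqP.
have zg : z ^ degree g = 1.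
  by apply: (mulIf pg); rewrite mul1r -coefq.
case: (degree g) zg => n //; rewrite NegzE -invr_expz => /(congr1 GRing.inv).
by rewrite invrK invr1.
Qed.

End IsotropicIdempotents.

(** * The relative commutant of C(X) *)

Section Commutant.
Variables (R : realType) (A : finType) (X : shift_space A) (O : shift_algebra R X).
Local Notation G := (groupoid X).
Local Notation C := (R[i]^o).
Implicit Types (g : G) (p a b : O) (h : shift_cover X -> C)
  (t s : shift_cover X).

Definition in_shift_commutant a := forall c, shift_subalgebra O c -> cmul a c = cmul c a.

Lemma factor_comp_continuous (f : full_shift A -> C) :
  {within X, continuous f} -> continuous (f \o @cover_factor A X).
Proof.
move=> /subspace_continuousP cf t U nU.
have := cf _ (cover_factor_in t) U nU; rewrite /= /within /= => h.
have H : nbhs t (@cover_factor A X @^-1` [set y | shift_set X y -> U (f y)]).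
  exact: (@cover_factor_continuous _ X t _ h).
suff : nbhs t [set s | U (f (@cover_factor A X s))] by [].
apply: (filterS _ H) => s /=; apply; exact: cover_factor_in.
Qed.

Lemma locally_constant_continuous (T : topologicalType) (f : T -> C) :
  (forall y, \forall z \near y, f z = f y) -> continuous f.
Proof.
move=> h y; apply: (@near_eq_continuous _ _ _ (fun=> f y)); first exact: h.
exact: cst_continuous.
Qed.

Lemma diagM h h' : continuous h -> continuous h' ->
  cmul (diag O h) (diag O h') = diag O (fun t => h t * h' t).
Proof.
move=> ch ch'; have chh : continuous (fun t => h t * h' t : C).
  by move=> t; apply: continuousM; [exact: ch|exact: ch'].
apply/eqP; rewrite -subr_eq0; apply/eqP; apply: coef_inj => g.
rewrite coefB coef_diagl // !coef_diag //.
have [ug|ug] := pselect (is_unit g); first by rewrite !extend_unitsE // subrr.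
by rewrite !extend_unitsN // mulr0 subrr.
Qed.

Lemma diag_commutes h : continuous h -> in_shift_commutant (diag O h).
Proof.
move=> ch _ [f cf <-]; have cf' := factor_comp_continuous cf.
rewrite -/(diag O (f \o cover_factor)) !diagM //.
by congr diag; apply: funext => t; rewrite mulrC.
Qed.

(** C(X) separates the points of X: a is tested against a function of the one
    letter at which two given points differ. *)
Lemma commutes_factor a g : in_shift_commutant a -> coef a g != 0 ->
  cover_factor (range_of g) = cover_factor (source_of g).
Proof.
move=> ca ag; apply: contrapT => ne.
have [n hn] : exists n, cover_factor (range_of g) n <> cover_factor (source_of g) n.
  apply: contrapT => H; apply: ne; apply: funext => n.
  by apply: contrapT => hn; apply: H; exists n.
pose f (y : full_shift A) : C := (y n == cover_factor (range_of g) n)%:R.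
have cf : continuous f.
  pose F (c : discrete_topology A) : C := ((c : A) == cover_factor (range_of g) n)%:R.
  have cF : continuous F.
    apply: locally_constant_continuous => c.
    suff : nbhs c [set c' | F c' = F c] by [].
    by rewrite nbhs_principalE; exact/principal_filterP.
  move=> y; apply: (@continuous_comp _ _ _
    (fun y : prod_topology (fun _ : nat => discrete_topology A) => y n) F).
    exact: (@proj_continuous _ (fun _ : nat => discrete_topology A) n).
  exact: cF.
have wf : {within X, continuous f} by exact: continuous_subspaceT.
have cfp := factor_comp_continuous wf.
have mem : shift_subalgebra O (diag O (f \o cover_factor)) by exists f.
have := congr1 (fun b => coef b g) (ca _ mem).
rewrite coef_diagl // coef_diagr //= /f eqxx mul1r.
have /eqP/negPf -> : cover_factor (source_of g) n <> cover_factor (range_of g) n.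
  exact: nesym.
by rewrite mulr0 => a0; move: ag; rewrite a0 eqxx.
Qed.

(** By [commutes_factor] and [coef_continuous], the set where the coefficients of
    a do not vanish is as in [open_fiber_isotropy]. *)
Lemma commutant_coef a g : in_shift_commutant a -> coef a g != 0 -> ~ is_unit g ->
  range_of g = source_of g /\ open [set range_of g].
Proof.
move=> ca ag ng; apply: (@open_fiber_isotropy _ _ g [set k | coef a k != 0]) => //.
  rewrite openE => k /= ak.
  have ak0 : 0 < modulus (coef a k).
    rewrite lt_neqAle modulus_ge0 andbT eq_sym; apply: contraNneq ak => m0.
    by apply/eqP; apply: modulus_le0; rewrite m0.
  have /modulus_continuousP/(_ _ ak0) := @coef_continuous _ _ _ O a k.
  apply: filterS => l hl /=; apply/eqP => l0; move: hl.
  by rewrite l0 sub0r modulusN ltxx.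
by move=> k; exact: commutes_factor.
Qed.

Definition indicator t : shift_cover X -> C := fun s => (s == t)%:R.

Lemma indicator_continuous t : open [set t] -> continuous (indicator t).
Proof.
move=> ot; apply: locally_constant_continuous => s; rewrite /indicator.
have [->|st] := eqVneq s t.
  apply: (@filterS _ _ _ [set t]); first by move=> _ ->; rewrite eqxx.
  exact: open_nbhs_nbhs.
apply: (@filterS _ _ _ (~` [set t])).
  by move=> r /= /eqP/negPf ->.
apply: open_nbhs_nbhs; split; last by apply/eqP.
exact/closed_openC/cover_set1_closed.
Qed.

Lemma indicator_commutes t a : open [set t] -> in_shift_commutant a ->
  cmul (diag O (indicator t)) a = cmul a (diag O (indicator t)).
Proof.
move=> ot ca; have ci := indicator_continuous ot.
apply/eqP; rewrite -subr_eq0; apply/eqP; apply: coef_inj => g.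
rewrite coefB coef_diagl // coef_diagr //.
have [->|ag] := eqVneq (coef a g) 0; first by rewrite mulr0 mul0r subrr.
have -> : range_of g = source_of g.
  have [[]//|ng] := pselect (is_unit g); by have [] := commutant_coef ca ag ng.
by rewrite mulrC subrr.
Qed.

(** A compactly supported function that is cut on both sides to the isolated
    point t is a Laurent polynomial on the isotropy group of t. *)
Lemma corner_isotropic_limit t a : open [set t] ->
  isotropic_limit t (cmul (cmul (diag O (indicator t)) a) (diag O (indicator t))).
Proof.
move=> ot e e0; have ci := indicator_continuous ot.
set d := diag O (indicator t); pose K := nrm d * nrm d + 1.
have K0 : 0 < K by rewrite ltr_wpDl // mulr_ge0 ?nrm_ge0.
have [f cf hf] := Cc_approx a (divr_gt0 e0 K0).
pose f1 : G -> C := fun g => indicator t (range_of g) * f g.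
pose f2 : G -> C := fun g => f1 g * indicator t (source_of g).
have cf1 : Cc f1 by exact: Cc_mull.
have cf2 : Cc f2 by exact: Cc_mulr.
have sup g : f2 g != 0 -> f g != 0 /\ isotropy t g.
  rewrite /f2 /f1 /indicator /isotropy /=.
  case: (eqVneq (range_of g) t) => [->|_]; last by rewrite !mul0r eqxx.
  case: (eqVneq (source_of g) t) => [->|_]; last by rewrite mulr0 eqxx.
  by rewrite mul1r mulr1.
exists f2.
  split; last by move=> g /sup[].
  have := compact_isotropy_finite ot cf.2; apply: sub_finite_set.
  by move=> g /= /sup[fg ig]; split=> //; exact: subset_closure.
have E : embed O f2 = cmul (cmul d (embed O f)) d.
  have cd : Cc (extend_units (indicator t)) := Cc_extend ci.
  have -> : cmul d (embed O f) = embed O f1.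
    by rewrite -embedM //; congr embed; apply: funext => g; exact: convolution_extendl.
  by rewrite -embedM //; congr embed; apply: funext => g; exact/esym/convolution_extendr.
rewrite E -cmulBl -cmulBr; apply: le_trans (nrm_cmul _ _) _.
apply: (@le_trans _ _ (nrm d * nrm (a - embed O f) * nrm d)).
  by apply: ler_wpM2r; [exact: nrm_ge0|exact: nrm_cmul].
rewrite mulrAC; apply: (@le_trans _ _ (K * (e / K))).
  by apply: ler_pM => //; rewrite ?mulr_ge0 ?nrm_ge0 // lerDl.
by rewrite mulrC divfK // gt_eqF.
Qed.

(** By [commutant_coef] a nonzero coefficient off the units sits over an isolated
    point. The corner of p at this point has the same coefficient and is again
    idempotent, against [isotropic_idempotent]. *)
Lemma commutant_idempotent p g : in_shift_commutant p -> cmul p p = p ->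
  ~ is_unit g -> coef p g = 0.
Proof.
move=> cp pp ng; apply: contrapT => /eqP pg.
have [rs ot] := commutant_coef cp pg ng.
set t := range_of g in rs ot; have ci := indicator_continuous ot.
(* Since d commutes with p, the corner d p d is the idempotent d p. *)
pose d := diag O (indicator t).
have dd : cmul d d = d.
  rewrite diagM //; congr diag; apply: funext => s; rewrite /indicator.
  by case: (eqVneq s t); rewrite ?mulr1 ?mulr0.
have dp := indicator_commutes ot cp; rewrite -/d in dp.
pose p' := cmul (cmul d p) d.
have p'E : p' = cmul d p by rewrite /p' -cmulA -dp cmulA dd.
have p'p' : cmul p' p' = p'.
  by rewrite p'E cmulA -(cmulA d p d) -dp (cmulA d d p) dd -(cmulA d p p) pp.
have lp : isotropic_limit t p' by exact: corner_isotropic_limit.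
have dg : degree g != 0 by apply/eqP => d0; apply: ng; split.
have := isotropic_idempotent ot lp p'p' dg.
rewrite p'E coef_diagl // /indicator /t eqxx mul1r => p0.
by rewrite p0 eqxx in pg.
Qed.

Lemma commutant_idempotent_diag p : in_shift_commutant p -> cmul p p = p ->
  exists2 h, continuous h & p = diag O h.
Proof.
by move=> cp pp; apply: units_in_diagonal => g; exact: commutant_idempotent.
Qed.

End Commutant.

(** * Transport along the isomorphism *)

Section Transfer.
Variables (R : realType) (A B : finType) (X : shift_space A) (Y : shift_space B).
Variables (OX : shift_algebra R X) (OY : shift_algebra R Y).
Variables (Phi : OX -> OY) (Psi : OY -> OX).
Hypotheses (PhiK : cancel Phi Psi) (PsiK : cancel Psi Phi).
Hypothesis PhiM : forall a b, Phi (cmul a b) = cmul (Phi a) (Phi b).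
Hypothesis PhiZ : forall (c : R[i]) a, Phi (c *: a) = c *: Phi a.
Hypothesis PhiC : Phi @` shift_subalgebra OX = shift_subalgebra OY.

Lemma PsiM a b : Psi (cmul a b) = cmul (Psi a) (Psi b).
Proof. by rewrite -{1}(PsiK a) -{1}(PsiK b) -PhiM PhiK. Qed.

Lemma PsiZ (c : R[i]) a : Psi (c *: a) = c *: Psi a.
Proof. by rewrite -{1}(PsiK a) -PhiZ PhiK. Qed.

Lemma Phi_commutes a : in_shift_commutant a -> in_shift_commutant (Phi a).
Proof. by move=> ca c; rewrite -PhiC => -[c' Cc' <-]; rewrite -!PhiM ca. Qed.

Lemma Psi_commutes a : in_shift_commutant a -> in_shift_commutant (Psi a).
Proof.
move=> ca c Xc; have Yc : shift_subalgebra OY (Phi c) by rewrite -PhiC; exists c.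
by rewrite -(PhiK c) -!PsiM ca.
Qed.

(** The indicator e of an isolated point has no proper idempotent multiples in
    the diagonal. If k is the restriction of h to a clopen set, then Phi k is an
    idempotent in the commutant, hence in the diagonal, and below e; it is therefore
    a multiple of e, and k is a multiple of h. So no clopen set separates two points
    of the support of h. *)
Lemma Psi_isolated_indicator (y : shift_cover Y) : open [set y] ->
  exists h, [/\ continuous h, Psi (diag OY (indicator R y)) = diag OX h &
    forall x s, h x != 0 -> h s != 0 -> s = x].
Proof.
move=> oy; have ci := indicator_continuous (R := R) oy.
pose e := diag OY (indicator R y).
have ee : cmul e e = e.
  rewrite diagM //; congr diag; apply: funext => s; rewrite /indicator.
  by case: (eqVneq s y); rewrite ?mulr1 ?mulr0.
have cq : in_shift_commutant (Psi e) by apply: Psi_commutes; exact: diag_commutes.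
have [|h ch qE] := commutant_idempotent_diag cq; first by rewrite -PsiM ee.
have hh s : h s * h s = h s.
  have := congr1 (fun a => coef (Psi a) (unit_arrow s)) ee; rewrite PsiM qE.
  by rewrite coef_diagl // coef_diag // extend_unitsE.
exists h; split=> // x s hx hs; apply: contrapT => sx.
have one u : h u != 0 -> h u = 1.
  by move=> hu; apply: (mulfI hu); rewrite hh mulr1.
have [N hN] := cover_neqP (nesym sx).
(* The restriction of h to a clopen set that contains x but not s. *)
pose k u : R[i]^o :=
  if `[< cover_coord u (level N) = cover_coord x (level N) >] then h u else 0.
have ck : continuous k.
  move=> u; have ou := open_nbhs_nbhs (conj (@coord_open _ _ u (level N)) erefl).
  have [ux|ux] := pselect (cover_coord u (level N) = cover_coord x (level N)).
    apply: (near_eq_continuous _ (ch u)); move: ou; apply: filterS => v /= vu.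
    by rewrite /k asboolT // vu.
  apply: (@near_eq_continuous _ _ _ (fun=> 0)); last exact: cst_continuous.
  by move: ou; apply: filterS => v /= vu; rewrite /k asboolF // vu.
have kk : cmul (diag OX k) (diag OX k) = diag OX k.
  rewrite diagM //; congr diag; apply: funext => u; rewrite /k.
  by case: asboolP => _; rewrite ?hh // mulr0.
have cPk : in_shift_commutant (Phi (diag OX k)) by apply: Phi_commutes; exact: diag_commutes.
have Pkk : cmul (Phi (diag OX k)) (Phi (diag OX k)) = Phi (diag OX k) by rewrite -PhiM kk.
have [l cl PkE] := commutant_idempotent_diag cPk Pkk.
have ePk : cmul e (Phi (diag OX k)) = Phi (diag OX k).
  rewrite -{1}(PsiK e) -PhiM qE diagM //; congr (Phi (diag _ _)); apply: funext => u.
  by rewrite /k; case: asboolP => _; rewrite ?hh // mulr0.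
have ePk' : cmul e (Phi (diag OX k)) = l y *: e.
  rewrite PkE diagM //; apply/eqP; rewrite -subr_eq0; apply/eqP; apply: coef_inj => g.
  have cil : continuous (fun t => indicator R y t * l t : R[i]^o).
    by move=> t; apply: continuousM; [exact: ci|exact: cl].
  rewrite coefB coefZ !coef_diag //.
  have [ug|ug] := pselect (is_unit g); last by rewrite !extend_unitsN // mulr0 subrr.
  rewrite !extend_unitsE // /indicator; case: (eqVneq (range_of g) y) => [->|_].
    by rewrite mul1r mulr1 subrr.
  by rewrite mul0r mulr0 subrr.
have kE : diag OX k = l y *: diag OX h by rewrite -(PhiK (diag OX k)) -ePk ePk' PsiZ qE.
have val u : k u = l y * h u.
  have := congr1 (fun a => coef a (unit_arrow u)) kE.
  by rewrite coefZ !coef_diag // !extend_unitsE.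
have l1 : l y = 1.
  by have := val x; rewrite /k asboolT // (one x hx) mulr1 => <-.
have := val s; rewrite /k asboolF // l1 mul1r => s0.
by rewrite -s0 eqxx in hs.
Qed.

(** By [commutant_coef], the image b of h' can have nonzero coefficients off the
    units only over isolated points y. For the indicator e of y, the product e b is
    the image of (Psi e) h', a multiple of Psi e by [Psi_isolated_indicator]. So e b
    is a multiple of e, and its coefficients off the units vanish. *)
Lemma Phi_diagonal a : diagonal_subalgebra OX a -> diagonal_subalgebra OY (Phi a).
Proof.
move=> [h' ch' <-]; rewrite -/(diag OX h').
have cb : in_shift_commutant (Phi (diag OX h')) by apply: Phi_commutes; exact: diag_commutes.
suff [h ch ->] : exists2 h, continuous h & Phi (diag OX h') = diag OY h by exists h.
apply: units_in_diagonal => g ng; apply: contrapT => /eqP bg.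
have [_ oy] := commutant_coef cb bg ng; set y := range_of g in oy.
have ci := indicator_continuous (R := R) oy.
have [h [ch qE hx]] := Psi_isolated_indicator oy.
have [c hc] : exists c : R[i], forall t, h t * h' t = c * h t.
  have [[x x0]|h0] := pselect (exists x, h x != 0).
    exists (h' x) => t; have [->|t0] := eqVneq (h t) 0; first by rewrite mul0r mulr0.
    by rewrite (hx _ _ x0 t0) mulrC.
  exists 0 => t; have [->|t0] := eqVneq (h t) 0; first by rewrite mul0r mulr0.
  by exfalso; apply: h0; exists t.
pose e := diag OY (indicator R y).
have E : cmul e (Phi (diag OX h')) = c *: e.
  have -> : cmul e (Phi (diag OX h')) = Phi (cmul (Psi e) (diag OX h')).
    by rewrite PhiM PsiK.
  have -> : c *: e = Phi (c *: Psi e) by rewrite PhiZ PsiK.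
  suff -> : cmul (Psi e) (diag OX h') = c *: Psi e by [].
  rewrite qE (diagM OX ch ch').
  have chh : continuous (fun t => h t * h' t : R[i]^o).
    by move=> t; apply: continuousM; [exact: ch|exact: ch'].
  apply/eqP; rewrite -subr_eq0; apply/eqP; apply: coef_inj => k.
  rewrite coefB coefZ !coef_diag //.
  have [uk|uk] := pselect (is_unit k); last by rewrite !extend_unitsN // mulr0 subrr.
  by rewrite !extend_unitsE // hc subrr.
have := congr1 (fun a => coef a g) E.
rewrite coef_diagl // coefZ coef_diag // extend_unitsN // mulr0 /indicator eqxx mul1r.
by move=> b0; rewrite b0 eqxx in bg.
Qed.

End Transfer.

Theorem theorem3p3 (R : realType) (A B : finType)
    (X : shift_space A) (Y : shift_space B)
    (OX : shift_algebra R X) (OY : shift_algebra R Y)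
    (Phi : {linear OX -> OY}) (hPhi : star_isomorphism Phi)
    (hC : Phi @` shift_subalgebra OX = shift_subalgebra OY) :
  Phi @` diagonal_subalgebra OX = diagonal_subalgebra OY.
Proof.
have [[Psi PhiK PsiK] PhiM _] := hPhi.
have PhiZ (c : R[i]) a : Phi (c *: a) = c *: Phi a by rewrite linearZ.
have hC' : Psi @` shift_subalgebra OY = shift_subalgebra OX.
  rewrite -hC image_comp; apply/seteqP.
  by split=> [_ [a Xa <-]|a Xa] /=; [rewrite PhiK|exists a].
apply/seteqP; split=> [_ [a Xa <-]|b Yb].
  exact: (Phi_diagonal PhiK PsiK PhiM PhiZ hC).
exists (Psi b); last exact: PsiK.
exact: (Phi_diagonal PsiK PhiK (PsiM PhiK PsiK PhiM) (PsiZ PhiK PsiK PhiZ) hC').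
Qed.
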